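(* For $1\le i\le i+m\le n-1$ and all $k_1,\dots,k_m,p\in\mathbb C$, $f^{(k_1,\dots,k_m)}_{i\cdots i+m}*f^{(k_1+p,\dots,k_m+p)}_{i\cdots i+m}=f^{(k_1+p,\dots,k_m+p)}_{i\cdots i+m}*f^{(k_1,\dots,k_m)}_{i\cdots i+m}$.
   Context: Fix an integer $n\ge2$, an integer $r>0$, a real $0<x<1$ and a complex parameter $\delta$. Let $[u]=x^{u^2/r-u}\Theta_{x^{2r}}(x^{2u})$, $\Theta_q(z)=(z;q)_\infty(q/z;q)_\infty(q;q)_\infty$. A function of type $(a_1,\dots,a_{n-1})$ ($a_j\in\mathbb Z_{\ge0}$) is a function of variables $u^{(b)}_j$ ($1\le j\le n-1$, $1\le b\le a_j$) and $\kappa_1,\dots,\kappa_{n-1}$, symmetric in $(u^{(1)}_j,\dots,u^{(a_j)}_j)$ for each $j$. For $f$ of type $(a_j)$ and $g$ of type $(b_j)$, $f*g$ is the function of type $(a_j+b_j)$ in variables $u^{(\cdot)}_j,v^{(\cdot)}_j$: $(f*g)=S\Big(f(u;\kappa_1+(b_0-2b_1+b_2)\delta,\dots,\kappa_{n-1}+(b_{n-2}-2b_{n-1}+b_n)\delta)\,g(v;\kappa)\prod_{j,a\le a_j,b\le b_j}\frac{[u^{(a)}_j-v^{(b)}_j-\delta]}{[u^{(a)}_j-v^{(b)}_j]}\prod_{1\le j\le n-2,a\le a_j,b\le b_{j+1}}\frac{[u^{(a)}_j-v^{(b)}_{j+1}+\frac\delta2]}{[u^{(a)}_j-v^{(b)}_{j+1}]}\prod_{2\le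 j\le n-1,a\le a_j,b\le b_{j-1}}\frac{[u^{(a)}_j-v^{(b)}_{j-1}+\frac\delta2]}{[u^{(a)}_j-v^{(b)}_{j-1}]}\Big)$, with $b_0=b_n=0$, where $S$ is the average over all permutations of $(u^{(1)}_j,\dots,u^{(a_j)}_j,v^{(1)}_j,\dots,v^{(b_j)}_j)$, independently for each $j$. For $1\le i\le i+m\le n-1$ and $k_1,\dots,k_m\in\mathbb C$ (with $k_0=-1$, $k_{m+1}=0$), $f^{(k_1,\dots,k_m)}_{i\cdots i+m}$ is the function of type $(a_j)$ with $a_j=1$ for $i\le j\le i+m$ and $0$ otherwise, given by $\prod_{j=1}^m\frac{[u_{i+j-1}-u_{i+j}-(k_j+\frac12)\delta]}{[u_{i+j-1}-u_{i+j}]}\prod_{j=0}^m[u_{i+j}-(k_j-k_{j+1}+\frac12)\delta-\kappa_{i+j}]$ (for $m=0$ this is $[u_i+\frac\delta2-\kappa_i]$). Equalities are identities of meromorphic functions. *)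

(* Defs.v *)
From Stdlib Require Import Reals.
From Coquelicot Require Import Coquelicot.
From mathcomp Require Import all_boot fingroup perm.

Set Implicit Arguments.
Unset Strict Implicit.
Unset Printing Implicit Defensive.

Local Open Scope C_scope.

Definition csum (l : seq C) : C := foldr Cplus (RtoC 0) l.
Definition cprod (l : seq nat) (F : nat -> C) : C :=
  foldr (fun j acc => F j * acc) (RtoC 1) l.

Definition cexp (z : C) : C :=
  @pair R R (Rmult (exp (Re z)) (cos (Im z))) (Rmult (exp (Re z)) (sin (Im z))).
Definition xpow (x : R) (w : C) : C := cexp (RtoC (ln x) * w).

Fixpoint Cpow_n (q : C) (k : nat) : C :=
  match k with O => RtoC 1 | S k' => q * Cpow_n q k' end.

Definition qpoch_part (z q : C) (N : nat) : C :=
  cprod (iota 0%nat N) (fun k => RtoC 1 - z * Cpow_n q k).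
Definition qpoch (z q : C) : C :=
  @pair R R (real (Lim_seq (fun N => Re (qpoch_part z q N))))
            (real (Lim_seq (fun N => Im (qpoch_part z q N)))).

Definition Theta (q z : C) : C := qpoch z q * qpoch (q / z) q * qpoch q q.

Definition brk (x : R) (r : nat) (u : C) : C :=
  xpow x (u * u / RtoC (INR r) - u) *
  Theta (RtoC (x ^ (2 * r))) (xpow x (RtoC 2 * u)).

(** A function of type (a_j): variables u_j^(b) are  w j b  (b < a j, the
    index b is 0-based), kappa_j is  kap j. *)
Definition vars := nat -> nat -> C.
Definition cfun := vars -> (nat -> C) -> C.

Definition permute_level (j N : nat) (s : {perm 'I_N}) (w : vars) : vars :=
  fun j' c =>
    if j' == j then
      match (insub c : option 'I_N) with
      | Some c' => w j (nat_of_ord (s c'))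
      | None => w j c
      end
    else w j' c.

Definition sym_level (j N : nat) (F : vars -> C) : vars -> C :=
  fun w => csum [seq F (@permute_level j N s w) | s : {perm 'I_N}]
           / RtoC (INR (N`!)).

Definition sym (n : nat) (N : nat -> nat) (F : vars -> C) : vars -> C :=
  foldr (fun j G => @sym_level j (N j) G) F (iota 1%nat (n - 1)).

Definition star (x : R) (r n : nat) (delta : C) (a b : nat -> nat)
    (f g : cfun) : cfun :=
  fun w kap =>
    let bb := fun j : nat => if ((0 < j) && (j < n))%N then b j else 0%nat in
    sym n (fun j => (a j + b j)%nat)
      (fun w' =>
         let u := fun j c => w' j c in
         let v := fun j c => w' j (a j + c)%nat in
         let kap' := fun j => kap j +
             (RtoC (INR (bb (j - 1)%nat)) - RtoC 2 * RtoC (INR (bb j))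
              + RtoC (INR (bb (j + 1)%nat))) * delta in
         f u kap' * g v kap
         * cprod (iota 1%nat (n - 1)) (fun j =>
             cprod (iota 0%nat (a j)) (fun c => cprod (iota 0%nat (b j)) (fun d =>
               brk x r (u j c - v j d - delta) / brk x r (u j c - v j d))))
         * cprod (iota 1%nat (n - 2)) (fun j =>
             cprod (iota 0%nat (a j)) (fun c => cprod (iota 0%nat (b (j + 1)%nat)) (fun d =>
               brk x r (u j c - v (j + 1)%nat d + delta / RtoC 2)
               / brk x r (u j c - v (j + 1)%nat d))))
         * cprod (iota 2%nat (n - 2)) (fun j =>
             cprod (iota 0%nat (a j)) (fun c => cprod (iota 0%nat (b (j - 1)%nat)) (fun d =>
               brk x r (u j c - v (j - 1)%nat d + delta / RtoC 2)
               / brk x r (u j c - v (j - 1)%nat d)))))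
      w.

Definition ftype (i m : nat) : nat -> nat :=
  fun j => if ((i <= j) && (j <= i + m))%N then 1%nat else 0%nat.

(** f^{(k_1..k_m)}_{i..i+m}; k_j = k j for 1 <= j <= m, k_0 = -1, k_{m+1} = 0;
    u_{i+j} is the unique variable w (i+j) 0 of level i+j. *)
Definition fk (x : R) (r : nat) (delta : C) (i m : nat) (k : nat -> C) : cfun :=
  fun w kap =>
    let kk := fun j => if j == 0%nat then RtoC (-1) else
                       if j == (m + 1)%nat then RtoC 0 else k j in
    let u := fun j => w j 0%nat in
    cprod (iota 1%nat m) (fun j =>
      brk x r (u (i + j - 1)%nat - u (i + j)%nat - (kk j + / RtoC 2) * delta)
      / brk x r (u (i + j - 1)%nat - u (i + j)%nat))
    * cprod (iota 0%nat (m + 1)) (fun j =>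
      brk x r (u (i + j)%nat - (kk j - kk (j + 1)%nat + / RtoC 2) * delta
               - kap (i + j)%nat)).

(** genericity: all brackets of differences of distinct variables (of a
    function of type N) are nonzero; on this dense open set all
    expressions are holomorphic, so equality there = equality of
    meromorphic functions. *)
Definition generic (x : R) (r n : nat) (N : nat -> nat) (w : vars) : Prop :=
  forall j j' c c' : nat,
    (1 <= j <= n - 1)%nat -> (1 <= j' <= n - 1)%nat ->
    (c < N j)%nat -> (c' < N j')%nat -> (j, c) <> (j', c') ->
    brk x r (w j c - w j' c') <> RtoC 0.

(* Main.v *)
Require Import Defs.
From Stdlib Require Import Reals ZArith Lra Lia FunctionalExtensionality.
From Coquelicot Require Import Coquelicot.
From HB Require Import structures.
From mathcomp Require Import all_boot fingroup perm zify.

(** Put [u_j, v_j] for the two variables of level [j] and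
    [W(u,v) = [u-v-delta]/[u-v]].  For [q = p delta] the operator
      [(X A)(u,v) = ([delta][u-v-q] A(u,v) + [q][u-v+delta] A(v,u)) / [u-v]]
    is self-adjoint for the pairing [sum A W B] over the two orderings of
    [u, v].  By the three-term theta identity, [X] applied to the factor of
    the left (right) end for one order of the parameters is [[q+delta]] times
    that factor for the other order, and [X] acting on one end of a bond between
    neighbouring levels equals [X] acting on the other end with the
    parameters exchanged.  Moving [X] along the chain of levels proves
    [[q+delta] (f*g - g*f) = 0].  The zeros of the bracket are isolated and both sides
    are continuous in [p], so the factor [[q+delta]] can be dropped.

    The three-term identity comes from the series
    [[u] = sum_n (-1)^n x^((u+rn)^2/r - (u+rn))] (Jacobi triple product):
    summing [[X+Y][X-Y]] over the pairs of indices of equal and of opposite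
    parity yields a determinant [F(X)G(Y) - G(X)F(Y)], and the identity is
    the Pluecker relation of such determinants. *)

Set Implicit Arguments.
Unset Strict Implicit.
Unset Printing Implicit Defensive.

(* zify rebinds the delimiting keys R and Z. *)
Delimit Scope R_scope with R.
Delimit Scope Z_scope with Z.

Local Open Scope C_scope.

(** * The exchange operator *)

(** A common shift by p leaves the differences k_j - k_{j+1} unchanged, so at an interior level the
    site factors of f and g have equal shifts and their product is symmetric in the two variables:
    it passes through X. The shift p is felt only on the bonds and at the two ends, where k_0 = -1
    and k_{m+1} = 0 stay fixed. The displacement of kappa in the star product is the second
    difference of (1, ..., 1) times delta: zero inside and -delta at both ends. With these boundary
    values each end factor gets exactly the shape that a three-term identity can exchange. The
    obstacle is that the argument yields the commutation only up to [q + delta], which vanishes for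
    exceptional p. Such a p is approached by p + s / delta with s small and real; hence the case
    delta = 0 is treated apart, as is m = 0, where the two ends coincide. *)

Lemma Csub_eq0 (x y : C) : x - y = 0 -> x = y.
Proof. by move=> h; rewrite -[y]Cplus_0_l -h; ring. Qed.

Lemma Csub_diag (x y : C) : x = y -> x - y = 0.
Proof. by move=> ->; ring. Qed.

Definition three_term (br : C -> C) : Prop := forall a b c d : C,
  br (a + b) * br (a - b) * (br (c + d) * br (c - d))
  - br (a + c) * br (a - c) * (br (b + d) * br (b - d))
  + br (a + d) * br (a - d) * (br (b + c) * br (b - c)) = 0.

Section Exchange.
Variables (br : C -> C) (delta : C).
Hypothesis br_odd : forall u, br (- u) = - br u.
Hypothesis br3 : three_term br.

Lemma br_sub_swap u v : br (u - v) = - br (v - u).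
Proof. by rewrite -br_odd; congr br; ring. Qed.

(** In each of the three products the two brackets containing [a] have arguments with the same sum,
    so this is the three-term identity centred at half that sum. *)
Lemma end_exchange a q u v :
  br delta * br (u - v - q) * (br (u + (a + q + delta)) * br (v + a))
  + br q * br (u - v + delta) * (br (v + (a + q + delta)) * br (u + a))
  = br (u - v) * br (q + delta) * (br (u + (a + delta)) * br (v + (a + q))).
Proof.
set s := (u + v + a + a + q + delta) / 2.
have := br3 s (u + (a + q + delta) - s) (v + (a + q + delta) - s)
              (u + (a + delta) - s).
have -> : s + (u + (a + q + delta) - s) = u + (a + q + delta) by ring.
have -> : s - (u + (a + q + delta) - s) = v + a by rewrite /s; field.
have -> : s + (v + (a + q + delta) - s) = v + (a + q + delta) by ring.
have -> : s - (v + (a + q + delta) - s) = u + a by rewrite /s; field.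
have -> : s + (u + (a + delta) - s) = u + (a + delta) by ring.
have -> : s - (u + (a + delta) - s) = v + (a + q) by rewrite /s; field.
have -> : v + (a + q + delta) - s + (u + (a + delta) - s) = delta by rewrite /s; field.
have -> : v + (a + q + delta) - s - (u + (a + delta) - s) = - (u - v - q) by ring.
have -> : u + (a + q + delta) - s + (u + (a + delta) - s) = u - v + delta by rewrite /s; field.
have -> : u + (a + q + delta) - s - (u + (a + delta) - s) = q by ring.
have -> : u + (a + q + delta) - s + (v + (a + q + delta) - s) = q + delta by rewrite /s; field.
have -> : u + (a + q + delta) - s - (v + (a + q + delta) - s) = u - v by ring.
rewrite br_odd => h.
apply: Csub_eq0.
transitivity (RtoC 0 * (-(1)));[rewrite -h; ring|ring].
Qed.

(** The form of the right side matters: apart from [q] and the crossed brackets it contains only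
    [u-v-(u'-v')], which is common to all choices of [a] and [q], so two instances can be made to
    cancel. *)
Lemma cross_exchange a q u v u' v' :
  br (u' - v') * br (u - v - q) * (br (u - u' - a) * br (v - v' - (a + q)))
  - br (u - v) * br (u' - v' - q) * (br (u - u' - (a + q)) * br (v - v' - a))
  = br q * br (u - v - (u' - v')) * (br (u - v' - (a + q)) * br (v - u' - a)).
Proof.
have := br3 ((u - u' + (v - v') - a - a - q) / 2) ((u - v - (u' - v') + q) / 2)
            ((u' - v' + (u - v) - q) / 2) ((u' - v' - (u - v) + q) / 2).
set A := (u - u' + _ - a - a - q) / 2; set B := _ / 2; set D := _ / 2; set E := _ / 2.
have -> : A + B = u - u' - a by rewrite /A /B; field.
have -> : A - B = v - v' - (a + q) by rewrite /A /B; field.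
have -> : D + E = u' - v' by rewrite /D /E; field.
have -> : D - E = u - v - q by rewrite /D /E; field.
have -> : A + D = u - v' - (a + q) by rewrite /A /D; field.
have -> : A - D = v - u' - a by rewrite /A /D; field.
have -> : B + E = q by rewrite /B /E; field.
have -> : B - E = u - v - (u' - v') by rewrite /B /E; field.
have -> : A + E = v - v' - a by rewrite /A /E; field.
have -> : A - E = u - u' - (a + q) by rewrite /A /E; field.
have -> : B + D = u - v by rewrite /B /D; field.
have -> : B - D = - (u' - v' - q) by rewrite /B /D; field.
rewrite br_odd => h.
apply: Csub_eq0.
rewrite -[RHS]h; ring.
Qed.

(** Numerator of everything in the star product that joins two neighbouring levels: the bond of the
    first factor on [(u, u')], that of the second on [(v, v')], and the two mixed pairs with shift
    delta/2. *)
Definition bond_num a b u v u' v' :=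
  br (u - u' - a) * br (v - v' - b)
  * (br (u - v' + delta / 2) * br (u' - v + delta / 2)).

Definition bond_den u v u' v' :=
  br (u - u') * br (v - v') * (br (u - v') * br (u' - v)).

(** Two of the four brackets are reversed and their signs cancel. The denominator is thus common to
    all terms of [bond_num_exchange] and can be divided out. *)
Lemma bond_den_swapl u v u' v' : bond_den v u u' v' = bond_den u v u' v'.
Proof.
rewrite /bond_den (br_sub_swap u' u) (br_sub_swap v u'); ring.
Qed.

Lemma bond_den_swapr u v u' v' : bond_den u v v' u' = bond_den u v u' v'.
Proof.
rewrite /bond_den (br_sub_swap v' v) (br_sub_swap u' v); ring.
Qed.

Lemma bond_num_exchange a q u v u' v' :
  br (u' - v') * (br delta * br (u - v - q) * bond_num a (a + q) u v u' v'
                + br q * br (u - v + delta) * bond_num a (a + q) v u u' v')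
  = br (u - v) * (br delta * br (u' - v' - q) * bond_num (a + q) a u v u' v'
                + br q * br (u' - v' + delta) * bond_num (a + q) a u v v' u').
Proof.
have h1 := cross_exchange a q u v u' v'.
(* The same identity with [a := delta / 2] and [q := - delta] handles the mixed pairs. *)
have h2 := cross_exchange (delta / 2) (- delta) u v u' v'.
have e1 : delta / 2 + - delta = - (delta / 2) by field.
rewrite e1 br_odd in h2.
rewrite /bond_num.
have -> : br (u' - u + delta / 2) = - br (u - u' - delta / 2).
  by rewrite -br_odd; congr br; ring.
have -> : br (v' - v + delta / 2) = - br (v - v' - delta / 2).
  by rewrite -br_odd; congr br; ring.
have e2 : br (u' - v + delta / 2) = - br (v - u' - delta / 2).
  by rewrite -br_odd; congr br; ring.
have m2 z : z - - (delta / 2) = z + delta / 2 by ring.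
have m3 z : z - - delta = z + delta by ring.
rewrite !m2 !m3 in h2.
rewrite e2.
apply: Csub_eq0.
set X1 := br (u' - v') * _ * _ - _ in h1.
set X2 := br (u' - v') * _ * _ - _ in h2.
(* Each instance is weighted by the crossed brackets of the other; both right sides then become the
   same product and cancel. *)
transitivity (br delta * br (u - v' + delta / 2) * (- br (v - u' - delta / 2)) * X1
 - br q * br (u - v' - (a + q)) * br (v - u' - a) * X2).
  rewrite /X1 /X2; ring.
rewrite h1 h2; ring.
Qed.

Definition bond a b u v u' v' := bond_num a b u v u' v' / bond_den u v u' v'.

Lemma bond_exchange a q u v u' v' :
  br (u' - v') * (br delta * br (u - v - q) * bond a (a + q) u v u' v'
                + br q * br (u - v + delta) * bond a (a + q) v u u' v')
  = br (u - v) * (br delta * br (u' - v' - q) * bond (a + q) a u v u' v'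
                + br q * br (u' - v' + delta) * bond (a + q) a u v v' u').
Proof.
rewrite /bond (bond_den_swapl u v) (bond_den_swapr u v u' v') /Cdiv.
set d := / bond_den _ _ _ _.
have h := bond_num_exchange a q u v u' v'.
apply: Csub_eq0.
transitivity (d * (RtoC 0)); last by ring.
rewrite -(Csub_diag h); ring.
Qed.

(** [z1] and [z2] stand for A(u,v) and A(v,u). The division by [u - v] is left out; since [u - v] is
    odd under the exchange, [exch q v u] enters pairings with a minus sign. *)
Definition exch q (u v z1 z2 : C) :=
  br delta * br (u - v - q) * z1 + br q * br (u - v + delta) * z2.

Definition wt u v := br (u - v - delta) / br (u - v).

(* The exchange operator is self-adjoint for the pairing weighted by [wt]. *)
Lemma pairing_exch q u v y1 y2 z1 z2 t : br (u - v) <> 0 ->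
  wt u v * exch q u v y1 y2 * z1 * t + wt v u * (- exch q v u y2 y1) * z2 * t
  = wt u v * y1 * exch q u v z1 z2 * t + wt v u * y2 * (- exch q v u z2 z1) * t.
Proof.
move=> nz; rewrite /wt /exch (br_sub_swap v u).
have -> : br (v - u - delta) = - br (u - v + delta).
  by rewrite -br_odd; congr br; ring.
have -> : br (v - u + delta) = - br (u - v - delta).
  by rewrite -br_odd; congr br; ring.
field; exact: nz.
Qed.

(** Self-adjointness when the images on both sides are known: X sends [y] to [Q x] and [z] to [Q t].
    This closes the argument at the left end. *)
Lemma pairing_comm q Q u v x1 x2 y1 y2 z1 z2 t1 t2 : br (u - v) <> 0 ->
  exch q u v y1 y2 = br (u - v) * Q * x1 -> exch q v u y2 y1 = br (v - u) * Q * x2 ->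
  exch q u v z1 z2 = br (u - v) * Q * t1 -> exch q v u z2 z1 = br (v - u) * Q * t2 ->
  Q * (wt u v * (x1 * z1) + wt v u * (x2 * z2))
  = Q * (wt u v * (y1 * t1) + wt v u * (y2 * t2)).
Proof.
move=> nz h1 h2 h3 h4.
have := pairing_exch q y1 y2 z1 z2 (/ br (u - v)) nz.
rewrite h1 h2 h3 h4 (br_sub_swap v u) => P.
transitivity (wt u v * (br (u - v) * Q * x1) * z1 * / br (u - v)
   + wt v u * - (- br (u - v) * Q * x2) * z2 * / br (u - v)); first by field.
by rewrite P; field.
Qed.

(** [bond_exchange] turns X on [(u, v)] into X on [(u', v')] acting on the bond; [pairing_exch] then
    passes it from the bond to [z], whose image is known. *)
Lemma exch_step a q u v u' v' z1 z2 y1 y2 :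
  br (u' - v') <> 0 ->
  exch q u' v' z1 z2 = br (u' - v') * br (q + delta) * y1 ->
  exch q v' u' z2 z1 = br (v' - u') * br (q + delta) * y2 ->
  exch q u v
   (bond a (a + q) u v u' v' * wt u' v' * z1 + bond a (a + q) u v v' u' * wt v' u' * z2)
   (bond a (a + q) v u u' v' * wt u' v' * z1 + bond a (a + q) v u v' u' * wt v' u' * z2)
  = br (u - v) * br (q + delta) *
   (bond (a + q) a u v u' v' * wt u' v' * y1 + bond (a + q) a u v v' u' * wt v' u' * y2).
Proof.
move=> nz h1 h2.
have b1 := bond_exchange a q u v u' v'.
have b2 := bond_exchange a q u v v' u'.
(* The quotient converts the normalisation by [u'-v'] into the one by [u-v]. *)
have P := pairing_exch q (bond (a + q) a u v u' v') (bond (a + q) a u v v' u') z1 z2 (br (u - v) / br (u' - v')) nz.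
rewrite h1 h2 in P.
transitivity (wt u' v' * exch q u' v' (bond (a + q) a u v u' v') (bond (a + q) a u v v' u') *
    z1 * (br (u - v) / br (u' - v')) +
    wt v' u' * - exch q v' u' (bond (a + q) a u v v' u') (bond (a + q) a u v u' v') *
    z2 * (br (u - v) / br (u' - v'))).
- transitivity (wt u' v' * z1 * (br (u' - v') * (br delta * br (u - v - q) * bond a (a + q) u v u' v'
                + br q * br (u - v + delta) * bond a (a + q) v u u' v')) / br (u' - v')
   + wt v' u' * z2 * (br (v' - u') * (br delta * br (u - v - q) * bond a (a + q) u v v' u' + br q * br (u - v + delta) * bond a (a + q) v u v' u')) / br (v' - u')).
  + rewrite (br_sub_swap v' u') /exch; field; exact: nz.
  + rewrite b1 b2 (br_sub_swap v' u') /exch; field; exact: nz.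
rewrite P (br_sub_swap v' u'); field; exact: nz.
Qed.
End Exchange.

(** * Symmetrised chains *)

Definition swp (j : nat) (w : vars) : vars := fun l c =>
  if l == j then (if c == 0%N then w j 1%N else if c == 1%N then w j 0%N else w j c)
  else w l c.

Lemma swp_neq j l w : l != j -> swp j w l = w l.
Proof. by move=> /negbTE h; apply: functional_extensionality => c; rewrite /swp h. Qed.

Lemma swp0 j w : swp j w j 0%N = w j 1%N.
Proof. by rewrite /swp eqxx. Qed.

Lemma swp1 j w : swp j w j 1%N = w j 0%N.
Proof. by rewrite /swp eqxx. Qed.

Lemma swpK j w : swp j (swp j w) = w.
Proof.
apply: functional_extensionality => l; apply: functional_extensionality => c.
rewrite /swp eqxx; case: eqP => // ->.
by case: c => [|[|c]].
Qed.

Definition symswp (j : nat) (F : vars -> C) (w : vars) : C := (F w + F (swp j w)) / 2.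

Definition symrange (a s : nat) (F : vars -> C) : vars -> C := foldr symswp F (iota a s).

Lemma symrange_ext a s F G w :
  (forall w', (forall l, (l < a)%N -> w' l = w l) -> F w' = G w') ->
  symrange a s F w = symrange a s G w.
Proof.
elim: s a w => [|s IH] a w h /=; first by apply: h.
rewrite /symrange /= /symswp -!/(symrange _ _ _).
congr ((_ + _) / _); apply: IH => w' hw; apply: h => l la; rewrite hw; try lia.
- by [].
- by rewrite swp_neq //; lia.
Qed.

Lemma symrange_cst a s k F w : symrange a s (fun w => k * F w) w = k * symrange a s F w.
Proof.
elim: s a w => [|s IH] a w //=.
rewrite /symrange /= /symswp -!/(symrange _ _ _) !IH /Cdiv; ring.
Qed.

Lemma symrange_scal a s (c F : vars -> C) w :
  (forall w', (forall l, (l < a)%N -> w' l = w l) -> c w' = c w) ->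
  symrange a s (fun w => c w * F w) w = c w * symrange a s F w.
Proof.
move=> h; rewrite -symrange_cst; apply: symrange_ext => w' hw; by rewrite h.
Qed.

Lemma symrange_local b a s F :
  (forall w w' : vars, (forall l, (b <= l)%N -> w l = w' l) -> F w = F w') ->
  forall w w' : vars, (forall l, (b <= l)%N -> w l = w' l) ->
  symrange a s F w = symrange a s F w'.
Proof.
move=> hF; elim: s a => [|s IH] a w w' h /=; first by apply: hF.
rewrite /symrange /= /symswp -!/(symrange _ _ _).
rewrite (IH _ _ _ h); congr ((_ + _) / _); apply: IH => l lb.
apply: functional_extensionality => c; rewrite /swp.
by case: eqP => [e|_]; [rewrite -e h|rewrite h].
Qed.

Lemma eq_cprod (l : seq nat) (F G : nat -> C) : {in l, F =1 G} -> cprod l F = cprod l G.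
Proof.
elim: l => //= a l IH h; rewrite h ?mem_head // IH // => b bl; apply: h.
by rewrite in_cons bl orbT.
Qed.

Section Chain.
Variables (br : C -> C) (delta : C).
Hypothesis br_odd : forall u, br (- u) = - br u.
Hypothesis br3 : three_term br.

Definition site (e e' : nat -> C) l (w : vars) :=
  br (w l 0%N - e l) * br (w l 1%N - e' l).
Definition lbond (a b : nat -> C) l (w : vars) :=
  bond br delta (a l) (b l) (w l.-1 0%N) (w l.-1 1%N) (w l 0%N) (w l 1%N).
Definition lwt l (w : vars) := wt br delta (w l 0%N) (w l 1%N).
(** [a], [e] are the bond and site shifts of the first factor, [b], [e'] those of the second. The
    weight [lwt] of level [j] is left out: it belongs to the pairing over the orders of that level,
    not to the function on which X acts. *)
Definition chain (a b e e' : nat -> C) j s (w : vars) :=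
  site e e' j w * cprod (iota j.+1 s) (fun l => lbond a b l w * lwt l w * site e e' l w).

Lemma chainS a b e e' j s w :
  chain a b e e' j s.+1 w
  = site e e' j w * (lbond a b j.+1 w * lwt j.+1 w) * chain a b e e' j.+1 s w.
Proof. rewrite /chain /=; ring. Qed.

Lemma chain_local a b e e' j s (w w' : vars) :
  (forall l, (j <= l)%N -> w l = w' l) -> chain a b e e' j s w = chain a b e e' j s w'.
Proof.
move=> h; rewrite /chain /site /lbond /lwt h //; congr (_ * _).
apply: eq_cprod => l; rewrite mem_iota => hl; rewrite !h //; lia.
Qed.

(** Level [j] is not averaged, so X can still act on its ordered pair of variables. *)
Definition symchain a b e e' j s := symrange j.+1 s (chain a b e e' j s).

Lemma symchain_local a b e e' j s (w w' : vars) :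
  (forall l, (j <= l)%N -> w l = w' l) ->
  symchain a b e e' j s w = symchain a b e e' j s w'.
Proof. move=> h; apply: (symrange_local (b := j)) => //; exact: chain_local. Qed.

Lemma symchainS a b e e' j s w :
  symchain a b e e' j s.+1 w = site e e' j w *
   (bond br delta (a j.+1) (b j.+1) (w j 0%N) (w j 1%N) (w j.+1 0%N) (w j.+1 1%N)
    * wt br delta (w j.+1 0%N) (w j.+1 1%N) * symchain a b e e' j.+1 s w
  + bond br delta (a j.+1) (b j.+1) (w j 0%N) (w j 1%N) (w j.+1 1%N) (w j.+1 0%N)
    * wt br delta (w j.+1 1%N) (w j.+1 0%N) * symchain a b e e' j.+1 s (swp j.+1 w)) / 2.
Proof.
have E w' : symrange j.+2 s (chain a b e e' j s.+1) w' =
    site e e' j w' * (lbond a b j.+1 w' * lwt j.+1 w') * symchain a b e e' j.+1 s w'.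
  rewrite -(@symrange_scal _ _ (fun w => site e e' j w * (lbond a b j.+1 w * lwt j.+1 w)));
    first by apply: symrange_ext => w'' _; exact: chainS.
  by move=> w'' h; rewrite /site /lbond /lwt /= !h; try lia.
rewrite {1}/symchain {1}/symrange /= /symswp -!/(symrange _ _ _) !E.
rewrite /site /lbond /lwt /= (@swp_neq j.+1 j) ?swp0 ?swp1; last by lia.
rewrite /Cdiv; ring.
Qed.

Definition good lo hi (w : vars) :=
  forall l, (lo <= l <= hi)%N -> br (w l 0%N - w l 1%N) <> 0.

Lemma good_swp lo hi j w : good lo hi w -> good lo hi (swp j w).
Proof.
move=> h l hl; case: (eqVneq l j) => [<-|/swp_neq ->]; last exact: h.
rewrite swp0 swp1 (br_sub_swap br_odd) => z; apply: (h _ hl).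
by rewrite -[RHS]Copp_0 -z; ring.
Qed.

Lemma good_sub lo hi lo' hi' w : (lo <= lo')%N -> (hi' <= hi)%N ->
  good lo hi w -> good lo' hi' w.
Proof. move=> h1 h2 h l hl; apply: h; lia. Qed.

(** [al], [be], [e1], [e1'] describe f*g, and [be], [al], [e2], [e2'] describe g*f. The hypotheses
    on the ends are mirror images: X sends the f*g factor to the g*f factor at the right end [t],
    and the g*f factor to the f*g factor at the left end [i]. *)
Variables (al be e1 e1' e2 e2' : nat -> C) (q : C) (t : nat).
Variable (i : nat).
Hypothesis be_al : forall l, (i < l <= t)%N -> be l = al l + q.
Hypothesis interior : forall l, (i < l < t)%N ->
  [/\ e1' l = e1 l, e2 l = e1 l & e2' l = e1 l].
Hypothesis right_end : exists c, [/\ e1 t = - (c + q + delta), e1' t = - c,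
  e2 t = - (c + delta) & e2' t = - (c + q)].
Hypothesis left_end : exists c, [/\ e1 i = - (c + delta), e1' i = - (c + q),
  e2 i = - (c + q + delta) & e2' i = - c].

(** The induction moves from the right end to the left: [end_exchange] is the base, and [exch_step]
    uses the induction hypothesis for both orders of level [j.+1]. *)
Lemma symchain_exch s j w : (i < j)%N -> (j + s = t)%N -> good j t w ->
  exch br delta q (w j 0%N) (w j 1%N)
   (symchain al be e1 e1' j s w) (symchain al be e1 e1' j s (swp j w))
  = br (w j 0%N - w j 1%N) * br (q + delta) * symchain be al e2 e2' j s w.
Proof.
elim: s j w => [|s IH] j w ij js gw.
  have {js}-> : j = t by lia.
  rewrite /symchain /symrange /= /chain /= /site swp0 swp1.
  have [c [-> -> -> ->]] := right_end.
  have := end_exchange delta br_odd br3 c q (w t 0%N) (w t 1%N).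
  have E z y : z - - y = z + y by ring.
  rewrite /exch !E => h; transitivity (1 * (br (w t 0%N - w t 1%N) * br (q + delta) *
     (br (w t 0%N + (c + delta)) * br (w t 1%N + (c + q))))); last by ring.
  rewrite -h; ring.
have gw1 : good j.+1 t w by apply: good_sub gw; lia.
have := IH j.+1 w; have := IH j.+1 (swp j.+1 w).
rewrite swpK swp0 swp1 => h2 h1.
have {}h1 := h1 ltac:(lia) ltac:(lia) gw1.
have {}h2 := h2 ltac:(lia) ltac:(lia) (good_swp gw1).
have nz : br (w j.+1 0%N - w j.+1 1%N) <> 0 by apply: gw; lia.
have S := exch_step br_odd br3 (al j.+1) (w j 0%N) (w j 1%N) nz h1 h2.
rewrite !symchainS be_al; last by lia.
rewrite swp0 swp1 !(@swp_neq j j.+1); try lia.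
rewrite -(@symchain_local _ _ _ _ j.+1 s w (swp j w)); last first.
  by move=> l hl; rewrite swp_neq //; lia.
rewrite -(@symchain_local _ _ _ _ j.+1 s (swp j.+1 w) (swp j.+1 (swp j w))); last first.
  move=> l hl; apply: functional_extensionality => c; rewrite /swp.
  have -> : (l == j) = false by lia.
  by have -> : (j.+1 == j) = false by lia.
rewrite /site swp0 swp1.
(* All four shifts of an interior level agree, so the site factor is symmetric and comes out of
   [exch]. *)
have [-> -> ->] := interior (l := j) ltac:(lia).
set E := e1 j.
transitivity (br (w j 0%N - E) * br (w j 1%N - E) / 2 * (br (w j 0%N - w j 1%N) * br (q + delta) *
     (bond br delta (al j.+1 + q) (al j.+1) (w j 0%N) (w j 1%N) 
        (w j.+1 0%N) (w j.+1 1%N) * wt br delta (w j.+1 0%N) (w j.+1 1%N) *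
      symchain be al e2 e2' j.+1 s w +
      bond br delta (al j.+1 + q) (al j.+1) (w j 0%N) (w j 1%N) 
        (w j.+1 1%N) (w j.+1 0%N) * wt br delta (w j.+1 1%N) (w j.+1 0%N) *
      symchain be al e2 e2' j.+1 s (swp j.+1 w)))); last by rewrite /Cdiv; ring.
rewrite -S /exch /Cdiv; ring.
Qed.

(** At level [i] the image of the end factor comes from [end_exchange] and that of the remaining
    chain from [exch_step]; [pairing_comm] compares the two. *)
Lemma symchain_comm w : (i < t)%N -> good i t w ->
  br (q + delta) * symrange i (t - i).+1 (fun w => lwt i w * chain al be e1 e1' i (t - i) w) w
  = br (q + delta) * symrange i (t - i).+1 (fun w => lwt i w * chain be al e2 e2' i (t - i) w) w.
Proof.
move=> it gw.
have -> : (t - i = (t - i.+1).+1)%N by lia.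
set s := (t - i.+1)%N.
have E a b e e' : symrange i s.+2 (fun w => lwt i w * chain a b e e' i s.+1 w) w
   = symswp i (fun w => lwt i w * symchain a b e e' i s.+1 w) w.
  rewrite /symrange /= -!/(symrange _ _ _) /symswp.
  congr ((_ + _) / _);
  rewrite -(@symrange_scal _ _ (lwt i)) // => w' h; rewrite /lwt h //; lia.
rewrite !E {E} /symswp !symchainS be_al; last by lia.
have -> : symchain al be e1 e1' i.+1 s (swp i w) = symchain al be e1 e1' i.+1 s w.
  by apply: symchain_local => l hl; rewrite swp_neq //; lia.
have -> : symchain be al e2 e2' i.+1 s (swp i w) = symchain be al e2 e2' i.+1 s w.
  by apply: symchain_local => l hl; rewrite swp_neq //; lia.
have L a b e e' : symchain a b e e' i.+1 s (swp i.+1 (swp i w))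
   = symchain a b e e' i.+1 s (swp i.+1 w).
  apply: symchain_local => l hl; apply: functional_extensionality => c; rewrite /swp.
  have -> : (l == i) = false by lia.
  by have -> : (i.+1 == i) = false by lia.
rewrite !L {L} !(@swp_neq i i.+1); try lia.
rewrite /lwt /site swp0 swp1.
have gw1 : good i.+1 t w by apply: good_sub gw; lia.
have := @symchain_exch s i.+1 w ltac:(lia) ltac:(lia) gw1.
have := @symchain_exch s i.+1 (swp i.+1 w) ltac:(lia) ltac:(lia) (good_swp gw1).
rewrite swpK swp0 swp1 => h2 h1.
have nz : br (w i.+1 0%N - w i.+1 1%N) <> 0 by apply: gw; lia.
have nz0 : br (w i 0%N - w i 1%N) <> 0 by apply: gw; lia.
have S1 := exch_step br_odd br3 (al i.+1) (w i 0%N) (w i 1%N) nz h1 h2.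
have S2 := exch_step br_odd br3 (al i.+1) (w i 1%N) (w i 0%N) nz h1 h2.
have [c [-> -> -> ->]] := left_end.
have En z y : z - - y = z + y by ring.
rewrite !En.
set u := w i 0%N in S1 S2 nz0 *; set v := w i 1%N in S1 S2 nz0 *.
have L1 := end_exchange delta br_odd br3 c q u v.
have L2 := end_exchange delta br_odd br3 c q v u.
have := pairing_comm br_odd nz0 L1 L2 S1 S2.
move=> P.
have H Q A B Z A' B' Z' : Q * ((A * (B * Z / 2) + A' * (B' * Z' / 2)) / 2)
    = Q * (A * (B * Z) + A' * (B' * Z')) / 2 / 2 by rewrite /Cdiv; ring.
by rewrite !H P.
Qed.
End Chain.

(** * The product [star] as a symmetrised chain *)

HB.instance Definition _ :=
  Monoid.isComLaw.Build C (RtoC 0) Cplus Cplus_assoc Cplus_comm Cplus_0_l.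

Lemma csumE (l : seq C) : csum l = \big[Cplus/RtoC 0]_(x <- l) x.
Proof. by rewrite unlock. Qed.

Lemma sym_level0 j F : @sym_level j 0 F = F.
Proof.
apply: functional_extensionality => w.
have E (s : {perm 'I_0}) : permute_level j s w = w.
  apply: functional_extensionality => l; apply: functional_extensionality => c.
  rewrite /permute_level; case: eqP => // ->; case: insubP => //.
rewrite /sym_level /image_mem (eq_map (g := fun=> F w)); last by move=> s; rewrite E.
have : size (enum {perm 'I_0}) = 1%N by rewrite -cardE card_Sn.
case: (enum _) => [|s [|s' l]] // _.
rewrite /=; field.
Qed.

Lemma sym_level2 j F : @sym_level j 2 F = symswp j F.
Proof.
apply: functional_extensionality => w.
rewrite /sym_level /symswp csumE /image_mem.
have P : perm_eq (enum {perm 'I_2}) [:: 1%g; tperm (@ord0 1) ord_max].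
  have U : uniq [:: 1%g; tperm (@ord0 1) ord_max].
    rewrite /= inE andbT; apply/eqP => /(congr1 (fun s : {perm 'I_2} => s ord0)).
    by rewrite perm1 tpermL.
  rewrite perm_sym uniq_perm ?enum_uniq //.
  have [|//] := uniq_min_size (s2 := enum {perm 'I_2}) U (fun x _ => mem_enum _ x).
  by rewrite -cardE card_Sn.
rewrite big_map (perm_big _ P) /= big_cons big_seq1.
have -> : permute_level j (1 : {perm 'I_2})%g w = w.
  apply: functional_extensionality => l; apply: functional_extensionality => c.
  rewrite /permute_level; case: eqP => // ->; case: insubP => // c' _ <-.
  by rewrite perm1.
have -> : permute_level j (tperm (@ord0 1) ord_max) w = swp j w.
  apply: functional_extensionality => l; apply: functional_extensionality => c.
  rewrite /permute_level /swp; case: eqP => // _; case: insubP => [c' _ <-|].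
    by case: c' => [[|[|//]] h] /=; rewrite permE.
  by case: c => [|[|c]].
by [].
Qed.

Lemma ftypeE i m j : ftype i m j = ((i <= j) && (j <= i + m))%N :> nat.
Proof. by rewrite /ftype; case: ifP. Qed.

Lemma iota_split a s b t : (a <= b)%N -> (b + t <= a + s)%N ->
  iota a s = iota a (b - a) ++ iota b t ++ iota (b + t) (a + s - (b + t)).
Proof.
move=> h1 h2.
have {1}-> : s = ((b - a) + (t + (a + s - (b + t))))%N by lia.
by rewrite !iotaD; congr (_ ++ (iota _ _ ++ iota _ _)); lia.
Qed.

Lemma sym_ftype n i m F : (1 <= i)%N -> (i + m <= n - 1)%N ->
  sym n (fun j => (ftype i m j + ftype i m j)%N) F = symrange i m.+1 F.
Proof.
move=> h1 h2; rewrite /sym (@iota_split 1 (n - 1) i m.+1); try lia.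
have Hid (l : seq nat) G : {in l, forall j, ~~ ((i <= j) && (j <= i + m))%N} ->
    foldr (fun j => @sym_level j (ftype i m j + ftype i m j)) G l = G.
  elim: l => //= j l IH h; rewrite IH; last first.
    by move=> b bl; apply: h; rewrite in_cons bl orbT.
  by rewrite ftypeE (negbTE (h j (mem_head _ _))) sym_level0.
rewrite !foldr_cat Hid; last by move=> j; rewrite mem_iota => hj; lia.
rewrite (Hid (iota (i + m.+1) _)); last by move=> j; rewrite mem_iota => hj; lia.
rewrite /symrange.
have : {in iota i m.+1, forall j, ((i <= j) && (j <= i + m))%N}.
  by move=> j; rewrite mem_iota => hj; lia.
elim: (iota _ _) => //= j l IH h; rewrite IH; last first.
  by move=> b bl; apply: h; rewrite in_cons bl orbT.
by rewrite ftypeE (h j (mem_head _ _)) sym_level2.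
Qed.

Lemma cprod_cat (l1 l2 : seq nat) (F : nat -> C) : cprod (l1 ++ l2) F = cprod l1 F * cprod l2 F.
Proof.
elim: l1 => [|a l IH] /=; first by rewrite Cmult_1_l.
by rewrite /cprod /= in IH *; rewrite IH Cmult_assoc.
Qed.

Lemma cprod_mul (l : seq nat) (F G : nat -> C) : cprod l F * cprod l G = cprod l (fun j => F j * G j).
Proof.
elim: l => [|a l IH] /=; first by rewrite Cmult_1_l.
rewrite -IH; ring.
Qed.

Lemma cprod1 (l : seq nat) (F : nat -> C) : {in l, forall j, F j = 1} -> cprod l F = 1.
Proof.
elim: l => //= a l IH h; rewrite h ?mem_head // IH ?Cmult_1_l // => b bl.
by apply: h; rewrite in_cons bl orbT.
Qed.

Lemma cprod_subrange (a s b t : nat) (F : nat -> C) : (a <= b)%N -> (b + t <= a + s)%N ->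
  (forall j, ~~ (b <= j < b + t)%N -> F j = 1) ->
  cprod (iota a s) F = cprod (iota b t) F.
Proof.
move=> h1 h2 h; rewrite (iota_split h1 h2) !cprod_cat.
rewrite cprod1 ?Cmult_1_l; last by move=> j; rewrite mem_iota => hj; apply: h; lia.
rewrite [X in _ * X]cprod1 ?Cmult_1_r // => j; rewrite mem_iota => hj; apply: h; lia.
Qed.

Lemma cprod_shift (d a s : nat) (F : nat -> C) : cprod (iota (d + a) s) F = cprod (iota a s) (fun j => F (d + j)%N).
Proof. by rewrite iotaDl; elim: (iota a s) => //= b l ->. Qed.

Definition kext (m : nat) (k : nat -> C) (j : nat) : C :=
  if j == 0%N then RtoC (-1) else if j == (m + 1)%N then RtoC 0 else k j.

Definition shifted_kap (n i m : nat) (delta : C) (kap : nat -> C) : nat -> C :=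
  let bb := fun j : nat => if ((0 < j) && (j < n))%N then ftype i m j else 0%N in
  fun j => kap j + (RtoC (INR (bb (j - 1)%N)) - RtoC 2 * RtoC (INR (bb j))
                    + RtoC (INR (bb (j + 1)%N))) * delta.

Definition bond_shift (i m : nat) k (delta : C) (l : nat) := (kext m k (l - i)%N + / RtoC 2) * delta.
Definition site_shift (i m : nat) k (delta : C) (kap : nat -> C) l :=
  (kext m k (l - i)%N - kext m k (l - i + 1)%N + / RtoC 2) * delta + kap l.

Lemma Cinv0 : / RtoC 0 = 0.
Proof. by rewrite /Cinv /RtoC /=; f_equal; rewrite /Rdiv; ring. Qed.

(** As the inverse of zero is zero, this holds for all [a] and [b], and [star_symrange] may regroup
    denominators at every point. *)
Lemma Cinv_mul (a b : C) : / (a * b) = / a * / b.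
Proof.
have [->|na] := Ceq_dec a 0; first by rewrite Cmult_0_l Cinv0; ring.
have [->|nb] := Ceq_dec b 0; first by rewrite Cmult_0_r Cinv0; ring.
field; by split.
Qed.

Lemma cprod_ftype i m j j' F :
  cprod (iota 0 (ftype i m j)) (fun c => cprod (iota 0 (ftype i m j')) (fun d => F c d))
  = if ((i <= j <= i + m) && (i <= j' <= i + m))%N then F 0%N 0%N else 1.
Proof.
rewrite !ftypeE; case: (i <= j <= i + m)%N; case: (i <= j' <= i + m)%N; rewrite /=; ring.
Qed.

Lemma fkE x r delta i m k w kap : fk x r delta i m k w kap =
  cprod (iota i.+1 m) (fun l => brk x r (w l.-1 0%N - w l 0%N - bond_shift i m k delta l)
                             / brk x r (w l.-1 0%N - w l 0%N))
  * cprod (iota i m.+1) (fun l => brk x r (w l 0%N - site_shift i m k delta kap l)).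
Proof.
rewrite /fk -[i.+1]addn1 (cprod_shift i 1) -[in iota i m.+1](addn0 i) (cprod_shift i 0) addn1.
congr (_ * _); apply: eq_cprod => l; rewrite mem_iota => hl.
  rewrite /bond_shift /kext addn1; have -> : (i + l - i = l)%N by lia.
  by have -> : (i + l).-1 = (i + l - 1)%N by lia.
rewrite /site_shift /kext !addn1; have -> : (i + l - i = l)%N by lia.
congr brk; ring.
Qed.

Lemma star_symrange x r n delta i m k k' w kap :
  (1 <= i)%N -> (i + m <= n - 1)%N ->
  star x r n delta (ftype i m) (ftype i m) (fk x r delta i m k) (fk x r delta i m k') w kap
  = symrange i m.+1 (fun w => lwt (brk x r) delta i w *
     chain (brk x r) delta (bond_shift i m k delta) (bond_shift i m k' delta)
      (site_shift i m k delta (shifted_kap n i m delta kap))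
      (site_shift i m k' delta kap) i m w) w.
Proof.
move=> h1 h2; rewrite /star sym_ftype //; congr (symrange _ _ _ _).
apply: functional_extensionality => {}w; cbv beta zeta.
have -> : (fun j => kap j + (RtoC (INR (if ((0 < j - 1) && (j - 1 < n))%N then ftype i m (j - 1) else 0%N))
   - RtoC 2 * RtoC (INR (if ((0 < j) && (j < n))%N then ftype i m j else 0%N))
   + RtoC (INR (if ((0 < j + 1) && (j + 1 < n))%N then ftype i m (j + 1) else 0%N))) * delta)
   = shifted_kap n i m delta kap by [].
rewrite !fkE.
rewrite (@cprod_subrange 1 (n - 1) i m.+1); try lia; last first.
  by move=> j hj; rewrite cprod_ftype ifF //; lia.
rewrite (@cprod_subrange 1 (n - 2) i m); try lia; last first.
  by move=> j hj; rewrite cprod_ftype ifF //; lia.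
rewrite (@cprod_subrange 2 (n - 2) i.+1 m); try lia; last first.
  by move=> j hj; rewrite cprod_ftype ifF //; lia.
(* The second product of [star] indexes a bond by its left level; [chain] and the third product use
   the right level. *)
have -> F : cprod (iota i m) F = cprod (iota i.+1 m) (fun l => F l.-1).
  by rewrite -[i.+1]add1n (cprod_shift 1 i).
have S F : cprod (iota i m.+1) F = F i * cprod (iota i.+1 m) F by [].
rewrite !S {S}.
have P (a b c d e f g A0 B0 C0 : C) : a * (A0 * b) * (c * (B0 * d)) * (C0 * e) * f * g
   = (C0 * (A0 * B0)) * (a * b * c * d * e * f * g) by ring.
rewrite P !cprod_mul {P} /chain [RHS]Cmult_assoc; congr (_ * _).
  rewrite cprod_ftype ifT; last by lia.
  have e : ftype i m i = 1%N by rewrite ftypeE; lia.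
  by rewrite e /lwt /wt /site addn0.
apply: eq_cprod => l; rewrite mem_iota => hl.
rewrite !cprod_ftype !ifT; try lia.
have -> : (l.-1 + 1 = l)%N by lia.
have -> : (l - 1 = l.-1)%N by lia.
have e j : (i <= j <= i + m)%N -> ftype i m j = 1%N by rewrite ftypeE => ->.
rewrite !e; try lia.
rewrite /lbond /lwt /wt /site /bond /bond_num /bond_den !addn0 /Cdiv !Cinv_mul; ring.
Qed.

Lemma shifted_kap_interior n i m delta kap l : (0 < i)%N -> (i < l < i + m)%N -> (i + m <= n - 1)%N ->
  shifted_kap n i m delta kap l = kap l.
Proof.
move=> i0 h h2; rewrite /shifted_kap !ftypeE.
rewrite (_ : (0 < l - 1) && (l - 1 < n) = true)%N; last by lia.
rewrite (_ : (0 < l) && (l < n) = true)%N; last by lia.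
rewrite (_ : (0 < l + 1) && (l + 1 < n) = true)%N; last by lia.
have -> : (i <= l - 1 <= i + m)%N by lia.
have -> : (i <= l <= i + m)%N by lia.
have -> : (i <= l + 1 <= i + m)%N by lia.
rewrite /=; ring.
Qed.

(** Exactly one neighbour of an end level is occupied, so the second difference is -1; for [m = 0]
    it would be -2. *)
Lemma shifted_kap_end n i m delta kap l : (0 < i)%N -> (0 < m)%N ->
  (l == i) || (l == i + m)%N -> (i + m <= n - 1)%N ->
  shifted_kap n i m delta kap l = kap l - delta.
Proof.
move=> i0 m0 h h2; rewrite /shifted_kap.
rewrite (_ : (0 < l) && (l < n) = true)%N; last by lia.
have -> : ftype i m l = 1%N by rewrite ftypeE; lia.
case/orP: h => /eqP ->.
- rewrite (_ : (if _ then ftype i m (i - 1) else 0)%N = 0%N); last first.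
    by rewrite ftypeE; case: ifP => //; lia.
  rewrite (_ : (if _ then ftype i m (i + 1) else 0)%N = 1%N); last first.
    by rewrite ftypeE ifT; lia.
  rewrite /=; ring.
- rewrite (_ : (if _ then ftype i m (i + m - 1) else 0)%N = 1%N); last first.
    by rewrite ftypeE ifT; lia.
  rewrite (_ : (if _ then ftype i m (i + m + 1) else 0)%N = 0%N); last first.
    by rewrite ftypeE; case: ifP => //; lia.
  rewrite /=; ring.
Qed.

Lemma star_comm_scaled x r n delta i m k p w kap :
  (forall u, brk x r (- u) = - brk x r u) -> three_term (brk x r) ->
  (0 < i)%N -> (0 < m)%N -> (i + m <= n - 1)%N -> good (brk x r) i (i + m) w ->
  let f := fk x r delta i m k in let g := fk x r delta i m (fun j => k j + p) in
  brk x r (p * delta + delta) * star x r n delta (ftype i m) (ftype i m) f g w kap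
  = brk x r (p * delta + delta) * star x r n delta (ftype i m) (ftype i m) g f w kap.
Proof.
move=> odd tt i0 m0 im gw /=; rewrite !star_symrange //.
have K0 k' : kext m k' 0 = RtoC (-1) by [].
have Km k' : kext m k' m.+1 = 0 by rewrite /kext addn1 eqxx.
have Kp j : (0 < j <= m)%N -> kext m (fun j => k j + p) j = kext m k j + p.
  by move=> hj; rewrite /kext !ifF //; lia.
have E : (i + m - i = m)%N by lia.
have := @symchain_comm (brk x r) delta odd tt (bond_shift i m k delta)
  (bond_shift i m (fun j => k j + p) delta)
  (site_shift i m k delta (shifted_kap n i m delta kap))
  (site_shift i m (fun j => k j + p) delta kap)
  (site_shift i m (fun j => k j + p) delta (shifted_kap n i m delta kap))
  (site_shift i m k delta kap) (p * delta) (i + m)%N i.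
rewrite E; apply => //; last by lia.
- move=> l hl; rewrite /bond_shift Kp; last by lia.
  ring.
- move=> l hl; rewrite /site_shift shifted_kap_interior // Kp; last by lia.
  rewrite Kp; last by lia.
  by split; ring.
(* Read off from [e1' t = - c], the site of g as second factor, where kappa is not displaced. *)
- exists (- ((kext m k m + p + / 2) * delta) - kap (i + m)%N).
  rewrite /site_shift E addn1 !Km shifted_kap_end //; last by rewrite eqxx orbT.
  rewrite Kp; last by lia.
  by split; ring.
(* Read off from [e2' i = - c], the site of f as second factor; k_0 = -1 turns -1 + 1/2 into -1/2,
   which gives this form. *)
- exists ((kext m k 1%N + / 2) * delta - kap i).
  rewrite /site_shift subnn add0n !K0 shifted_kap_end // ?eqxx //.
  rewrite Kp; last by lia.
  by split; field.
Qed.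

(** * Limits of complex sequences *)

Lemma RtoC_neq (a b : R) : a <> b -> RtoC a <> RtoC b.
Proof. by move=> h /RtoC_inj. Qed.

Definition Clim (f : nat -> C) (l : C) := is_lim_seq (fun n => Cmod (f n - l)) 0.

Section ComplexLimits.
Local Open Scope R_scope.

Lemma Clim_squeeze (f : nat -> C) l (e : nat -> R) :
  (forall n, Cmod (f n - l)%C <= e n) -> is_lim_seq e 0 -> Clim f l.
Proof.
move=> h he; apply: (is_lim_seq_le_le (fun=> 0) _ e) => //; last exact: is_lim_seq_const.
by move=> n; split; [exact: Cmod_ge_0|].
Qed.

Lemma Clim_const l : Clim (fun=> l) l.
Proof.
apply: (Clim_squeeze (e := fun=> 0)); last exact: is_lim_seq_const.
move=> n; rewrite (_ : (l - l)%C = 0); last by ring.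
rewrite Cmod_0; lra.
Qed.

Lemma Clim_ext (f g : nat -> C) l : (forall n, f n = g n) -> Clim f l -> Clim g l.
Proof. by move=> h; apply: is_lim_seq_ext => n; rewrite h. Qed.

Lemma Clim_add f g l m : Clim f l -> Clim g m -> Clim (fun n => f n + g n)%C (l + m)%C.
Proof.
move=> hf hg; apply: (Clim_squeeze (e := fun n => Cmod (f n - l)%C + Cmod (g n - m)%C)).
  move=> n; rewrite (_ : (f n + g n - (l + m))%C = ((f n - l) + (g n - m))%C); last by ring.
  exact: Cmod_triangle.
by rewrite -[0]Rplus_0_r; apply: is_lim_seq_plus'.
Qed.

Lemma Clim_mul f g l m : Clim f l -> Clim g m -> Clim (fun n => f n * g n)%C (l * m)%C.
Proof.
move=> hf hg; apply: (Clim_squeeze (e := fun n => Cmod (f n - l)%C * Cmod (g n - m)%C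
   + (Cmod l * Cmod (g n - m)%C + Cmod m * Cmod (f n - l)%C))).
  move=> n; rewrite (_ : (f n * g n - l * m)%C
    = ((f n - l) * (g n - m) + (l * (g n - m) + m * (f n - l)))%C); last by ring.
  apply: Rle_trans; first exact: Cmod_triangle.
  rewrite Cmod_mult; apply: Rplus_le_compat_l.
  apply: Rle_trans; first exact: Cmod_triangle.
  rewrite !Cmod_mult; lra.
have -> : Rbar.Finite 0 = Rbar.Finite (0 * 0 + (Cmod l * 0 + Cmod m * 0))%R by f_equal; ring.
apply: is_lim_seq_plus'; first exact: is_lim_seq_mult'.
by apply: is_lim_seq_plus'; apply: is_lim_seq_mult' => //; exact: is_lim_seq_const.
Qed.

Lemma Clim_cmul c f l : Clim f l -> Clim (fun n => c * f n)%C (c * l)%C.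
Proof. exact: Clim_mul (Clim_const c). Qed.

Lemma Clim_sub f g l m : Clim f l -> Clim g m -> Clim (fun n => f n - g n)%C (l - m)%C.
Proof.
move=> hf hg; have := Clim_add hf (Clim_cmul (RtoC (-1)) hg).
rewrite (_ : (l + RtoC (-1) * m)%C = (l - m)%C); last by ring.
apply: Clim_ext => n; ring.
Qed.

Lemma Clim_unique f l m : Clim f l -> Clim f m -> l = m.
Proof.
move=> hl hm; have h := Clim_sub hl hm.
have {}h : Clim (fun=> RtoC 0) (l - m)%C by apply: Clim_ext h => n; ring.
have : Rbar.Finite (Cmod (RtoC 0 - (l - m))%C) = Rbar.Finite 0.
  by rewrite -(is_lim_seq_unique _ _ h) Lim_seq_const.
case=> /Cmod_eq_0 e; have -> : l = (m - (RtoC 0 - (l - m)))%C by ring.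
rewrite e; ring.
Qed.

Lemma Clim_diff f g l : Clim f l -> Clim (fun n => g n - f n)%C 0%R -> Clim g l.
Proof.
move=> hf h; have := Clim_add hf h; rewrite Cplus_0_r; apply: Clim_ext => n; ring.
Qed.

Lemma Cmod_le_Re_Im (z : C) : Cmod z <= Rabs (Re z) + Rabs (Im z).
Proof.
have {1}-> : z = (RtoC (Re z) + Ci * RtoC (Im z))%C.
  by case: z => a b; rewrite /Cplus /Cmult /=; f_equal; ring.
apply: Rle_trans; first exact: Cmod_triangle.
rewrite Cmod_mult Cmod_Ci !Cmod_R; lra.
Qed.

Lemma re_plus (a b : C) : Re (a + b)%C = Re a + Re b.
Proof. by []. Qed.

Lemma im_plus (a b : C) : Im (a + b)%C = Im a + Im b.
Proof. by []. Qed.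

Lemma re_minus (a b : C) : Re (a - b)%C = Re a - Re b.
Proof. by []. Qed.

Lemma im_minus (a b : C) : Im (a - b)%C = Im a - Im b.
Proof. by []. Qed.

Lemma Re_le_Cmod (z : C) : Rabs (Re z) <= Cmod z.
Proof. exact: Rle_trans (Rmax_l _ _) (Rmax_Cmod z). Qed.

Lemma Im_le_Cmod (z : C) : Rabs (Im z) <= Cmod z.
Proof. exact: Rle_trans (Rmax_r _ _) (Rmax_Cmod z). Qed.

Lemma is_lim_seq_squeeze0 (f : nat -> R) l (e : nat -> R) :
  (forall n, Rabs (f n - l) <= e n) -> is_lim_seq e 0 -> is_lim_seq f l.
Proof.
move=> h he; apply: (is_lim_seq_le_le (fun n => l - e n) _ (fun n => l + e n)).
- move=> n; have := h n; split_Rabs; lra.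
- rewrite -{2}[l]Rminus_0_r; apply: is_lim_seq_minus' => //; exact: is_lim_seq_const.
- rewrite -{2}[l]Rplus_0_r; apply: is_lim_seq_plus' => //; exact: is_lim_seq_const.
Qed.

Lemma Clim_Re f l : Clim f l -> is_lim_seq (fun n => Re (f n)) (Re l).
Proof.
move=> h; apply: is_lim_seq_squeeze0 h => n; rewrite -re_minus; exact: Re_le_Cmod.
Qed.

Lemma Clim_Im f l : Clim f l -> is_lim_seq (fun n => Im (f n)) (Im l).
Proof.
move=> h; apply: is_lim_seq_squeeze0 h => n; rewrite -im_minus; exact: Im_le_Cmod.
Qed.

Lemma is_lim_seq_Rabs0 (f : nat -> R) (l : R) : is_lim_seq f l ->
  is_lim_seq (fun n => Rabs (f n - l)) 0.
Proof.
move=> h; apply: (is_lim_seq_abs_0 _).1; rewrite (_ : Rbar.Finite 0 = Rbar.Finite (l - l)); last by f_equal; ring.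
by apply: is_lim_seq_minus' => //; exact: is_lim_seq_const.
Qed.

Lemma Clim_pair f (a b : R) : is_lim_seq (fun n => Re (f n)) a ->
  is_lim_seq (fun n => Im (f n)) b -> Clim f (a, b).
Proof.
move=> ha hb; apply: (Clim_squeeze (e := fun n => Rabs (Re (f n) - a) + Rabs (Im (f n) - b))).
  by move=> n; apply: Rle_trans (Cmod_le_Re_Im _) _; rewrite re_minus im_minus /=; lra.
by rewrite -[0]Rplus_0_r; apply: is_lim_seq_plus'; exact: is_lim_seq_Rabs0.
Qed.

Lemma ex_lim_of_increments (f b : nat -> R) :
  (forall n, Rabs (f n.+1 - f n) <= b n) -> ex_series b -> exists l : R, is_lim_seq f l.
Proof.
move=> h hb; have [l hl] : ex_series (fun n => f n.+1 - f n).
  exact: (@ex_series_le R_AbsRing R_CompleteNormedModule _ b).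
exists (f 0%N + l); apply: (is_lim_seq_incr_1 f _).2.
apply: (is_lim_seq_ext (fun n => f 0%N + sum_n (fun n => f n.+1 - f n) n)).
  elim=> [|n IH]; first by rewrite sum_O; ring.
  rewrite sum_Sn /plus /=; lra.
by apply: is_lim_seq_plus'; [exact: is_lim_seq_const|].
Qed.

Lemma Clim_of_increments (f : nat -> C) (b : nat -> R) :
  (forall n, Cmod (f n.+1 - f n)%C <= b n) -> ex_series b -> exists l, Clim f l.
Proof.
move=> h hb.
have [a ha] := @ex_lim_of_increments (fun n => Re (f n)) b
  (fun n => Rle_trans _ _ _ (eq_rect _ (fun z => Rabs z <= _) (Re_le_Cmod _) _ (re_minus _ _)) (h n)) hb.
have [c hc] := @ex_lim_of_increments (fun n => Im (f n)) b
  (fun n => Rle_trans _ _ _ (eq_rect _ (fun z => Rabs z <= _) (Im_le_Cmod _) _ (im_minus _ _)) (h n)) hb.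
by exists (a, c); exact: Clim_pair.
Qed.

Lemma Clim_bound f l M : Clim f l -> (forall n, Cmod (f n) <= M) -> Cmod l <= M.
Proof.
move=> h hM; have H : is_lim_seq (fun n => M + Cmod (f n - l)%C) (M + 0).
  by apply: is_lim_seq_plus' => //; exact: is_lim_seq_const.
rewrite Rplus_0_r in H.
apply: (is_lim_seq_le (fun=> Cmod l) _ (Cmod l) M _ _ H); last exact: is_lim_seq_const.
move=> n; have E : l = (f n + - (f n - l))%C by ring.
rewrite {1}E.
apply: Rle_trans; first exact: Cmod_triangle.
rewrite Cmod_opp; have := hM n; lra.
Qed.
End ComplexLimits.

(** * The complex exponential *)

Section ComplexExp.

Lemma cexp_add (a b : C) : cexp (a + b) = cexp a * cexp b.
Proof.
rewrite /cexp re_plus im_plus exp_plus cos_plus sin_plus /Cmult /=; f_equal; ring.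
Qed.

Lemma cexp_R (a : R) : cexp (RtoC a) = RtoC (exp a).
Proof. by rewrite /cexp /= cos_0 sin_0 /RtoC; f_equal; ring. Qed.

Lemma cexp0 : cexp 0 = 1.
Proof. by rewrite cexp_R exp_0. Qed.

Lemma Cmod_cexp w : Cmod (cexp w) = exp (Re w).
Proof.
rewrite /Cmod /cexp /= !Rmult_1_r.
have -> : (exp (Re w) * cos (Im w) * (exp (Re w) * cos (Im w)) +
   exp (Re w) * sin (Im w) * (exp (Re w) * sin (Im w)))%R
   = (Rsqr (exp (Re w)) * (Rsqr (sin (Im w)) + Rsqr (cos (Im w))))%R by rewrite /Rsqr; ring.
rewrite sin2_cos2 Rmult_1_r sqrt_Rsqr //; apply: Rlt_le; exact: exp_pos.
Qed.

Lemma cexp_neq0 w : cexp w <> 0.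
Proof.
move=> h; have := exp_pos (Re w); rewrite -Cmod_cexp h Cmod_0; lra.
Qed.

Lemma cexp_opp w : cexp (- w) = / cexp w.
Proof.
have h := @cexp_neq0 w; have e : cexp (- w) * cexp w = 1.
  by rewrite -cexp_add -cexp0; congr cexp; ring.
by rewrite -[LHS]Cmult_1_r -(Cinv_r _ h) Cmult_assoc e Cmult_1_l.
Qed.

Lemma Cpow_cexp w k : Cpow_n (cexp w) k = cexp (RtoC (INR k) * w).
Proof.
elim: k => [|k IH]; first by rewrite /= Cmult_0_l cexp0.
by rewrite /Cpow_n -/Cpow_n IH -cexp_add S_INR RtoC_plus; congr cexp; ring.
Qed.

Lemma sin_cos_sub_le b : (Rabs (sin b) <= Rabs b /\ Rabs (cos b - 1) <= Rabs b)%R.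
Proof.
split.
- have [c [e _]] := MVT_abs sin cos 0 b (fun c _ => derivable_pt_lim_sin c).
  rewrite sin_0 !Rminus_0_r in e; rewrite e -{2}[Rabs b]Rmult_1_l.
  apply: Rmult_le_compat_r; first exact: Rabs_pos.
  by apply: Rabs_le; exact: COS_bound.
- have [c [e _]] := MVT_abs cos (fun x => - sin x)%R 0 b (fun c _ => derivable_pt_lim_cos c).
  rewrite cos_0 !Rminus_0_r in e; rewrite e -{2}[Rabs b]Rmult_1_l.
  apply: Rmult_le_compat_r; first exact: Rabs_pos.
  by rewrite Rabs_Ropp; apply: Rabs_le; exact: SIN_bound.
Qed.

Lemma exp_sub1_le a : (Rabs (exp a - 1) <= Rabs a * exp (Rabs a))%R.
Proof.
have [c [e hc]] := MVT_abs exp exp 0 a (fun c _ => derivable_pt_lim_exp c).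
rewrite exp_0 !Rminus_0_r in e; rewrite e Rmult_comm.
apply: Rmult_le_compat_l; first exact: Rabs_pos.
rewrite Rabs_pos_eq; last by apply: Rlt_le; exact: exp_pos.
have : (c <= Rabs a)%R.
  apply: Rle_trans hc.2 _; apply: Rmax_lub; [exact: Rabs_pos|exact: Rle_abs].
case=> [h|->]; last exact: Rle_refl.
by apply: Rlt_le; apply: exp_increasing.
Qed.

Lemma exp_le a b : (a <= b)%R -> (exp a <= exp b)%R.
Proof. by case=> [h|->]; [apply: Rlt_le; apply: exp_increasing|exact: Rle_refl]. Qed.

(** For w = a + ib the three units of the constant are |e^a - 1| and e^a |cos b - 1| from the real
    part and e^a |sin b| from the imaginary part. *)
Lemma cexp_sub1 w : (Cmod (cexp w - 1) <= 3 * Cmod w * exp (Cmod w))%R.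
Proof.
apply: Rle_trans (Cmod_le_Re_Im _) _.
rewrite re_minus im_minus /= Rminus_0_r.
have ha := Re_le_Cmod w; have hb := Im_le_Cmod w.
move: (Re w) (Im w) ha hb => a b; move: (Cmod w) => M ha hb.
have [hs hc] := sin_cos_sub_le b; have he := exp_sub1_le a.
have ea : (exp a <= exp M)%R by apply: exp_le; have := Rle_abs a; lra.
have ea' : (exp (Rabs a) <= exp M)%R by apply: exp_le.
have e0 := exp_pos a; have e0' := exp_pos (Rabs a); have eM := exp_pos M.
have h1 : (Rabs (exp a * cos b - 1) <= Rabs (exp a - 1) + exp a * Rabs (cos b - 1))%R.
  have -> : (exp a * cos b - 1 = (exp a - 1) + exp a * (cos b - 1))%R by ring.
  apply: Rle_trans (Rabs_triang _ _) _; rewrite Rabs_mult (Rabs_pos_eq (exp a)); lra.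
have h2 : (Rabs (exp a * sin b) = exp a * Rabs (sin b))%R.
  by rewrite Rabs_mult (Rabs_pos_eq (exp a)) //; lra.
have M0 : (0 <= M)%R by have := Rabs_pos a; lra.
have k1 : (Rabs a * exp (Rabs a) <= M * exp M)%R.
  by apply: Rmult_le_compat => //; [exact: Rabs_pos|lra].
have k2 : (exp a * Rabs (sin b) <= exp M * M)%R.
  by apply: Rmult_le_compat => //; [lra|exact: Rabs_pos|lra].
have k3 : (exp a * Rabs (cos b - 1) <= exp M * M)%R.
  by apply: Rmult_le_compat => //; [lra|exact: Rabs_pos|lra].
rewrite h2; lra.
Qed.
End ComplexExp.

(** * Sums over symmetric ranges of integers *)

Lemma Rplus_associative : associative Rplus.
Proof. move=> x y z; ring. Qed.

HB.instance Definition _ :=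
  Monoid.isComLaw.Build R 0%R Rplus Rplus_associative Rplus_comm Rplus_0_l.

HB.instance Definition _ := hasDecEq.Build Z Z.eqb_spec.

Section IntegerRange.
Local Open Scope Z_scope.

Definition zs (N : nat) : seq Z := [seq Z.of_nat j - Z.of_nat N | j <- iota 0 (2 * N).+1].

Lemma mem_zs N (a : Z) : (a \in zs N) <-> (- Z.of_nat N <= a <= Z.of_nat N).
Proof.
split; first by move=> /mapP[j]; rewrite mem_iota => h ->; lia.
move=> h; apply/mapP; exists (Z.to_nat (a + Z.of_nat N)); last by lia.
rewrite mem_iota; lia.
Qed.

Lemma zs_uniq N : uniq (zs N).
Proof. by rewrite map_inj_uniq ?iota_uniq // => i j; lia. Qed.

Lemma eq_mem_iff (s1 s2 : seq Z) : (forall a, a \in s1 <-> a \in s2) -> s1 =i s2.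
Proof. by move=> h a; apply/idP/idP => /h. Qed.

(** Two new indices per step: convergence over the integers reduces to an ordinary series of
    increments. *)
Lemma zsS N : perm_eq (zs N.+1) [:: Z.of_nat N.+1, - Z.of_nat N.+1 & zs N].
Proof.
apply: uniq_perm; first exact: zs_uniq.
  rewrite cons_uniq cons_uniq zs_uniq andbT in_cons negb_or -andbA; apply/and3P; split.
  - by apply/eqP; lia.
  - apply/negP => /mem_zs; lia.
  - apply/negP => /mem_zs; lia.
apply: eq_mem_iff => a; rewrite mem_zs in_cons in_cons; split.
  case: (Z.eq_dec a (Z.of_nat N.+1)) => [->|h1] h; first by rewrite eqxx.
  case: (Z.eq_dec a (- Z.of_nat N.+1)) => [->|h2]; first by rewrite eqxx orbT.
  by rewrite (_ : a \in zs N) ?orbT //; apply/mem_zs; lia.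
case/or3P => [/eqP->|/eqP->|/mem_zs]; lia.
Qed.
End IntegerRange.

Definition csumZ (N : nat) (F : Z -> C) : C := \big[Cplus/RtoC 0]_(a <- zs N) F a.
Definition rsumZ (N : nat) (f : Z -> R) : R := \big[Rplus/0%R]_(a <- zs N) f a.

Lemma csumZS N F : csumZ N.+1 F
  = csumZ N F + (F (Z.of_nat N.+1) + F (- Z.of_nat N.+1)%Z).
Proof. rewrite /csumZ (perm_big _ (zsS N)) /= !big_cons; ring. Qed.

Lemma rsumZS N f : (rsumZ N.+1 f
  = rsumZ N f + (f (Z.of_nat N.+1) + f (- Z.of_nat N.+1)%Z))%R.
Proof. rewrite /rsumZ (perm_big _ (zsS N)) /= !big_cons; ring. Qed.

(** * Absolute values of finite sums and Gaussian decay *)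

Section BigReal.
Local Open Scope R_scope.

Lemma Cmod_bigC (I : Type) (s : seq I) (P : pred I) (F : I -> C) :
  Cmod (\big[Cplus/RtoC 0]_(a <- s | P a) F a) <= \big[Rplus/0]_(a <- s | P a) Cmod (F a).
Proof.
elim/big_rec2: _ => [|a x z _ h]; first by rewrite Cmod_0; lra.
apply: Rle_trans (Cmod_triangle _ _) _; lra.
Qed.

Lemma bigR_le (I : Type) (s : seq I) (P : pred I) (f g : I -> R) :
  (forall a, P a -> f a <= g a) ->
  \big[Rplus/0]_(a <- s | P a) f a <= \big[Rplus/0]_(a <- s | P a) g a.
Proof. by move=> h; elim/big_rec2: _ => [|a x z Pa hx]; [lra|have := h a Pa; lra]. Qed.

Lemma bigR_le_seq (I : eqType) (s : seq I) (f g : I -> R) :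
  (forall a, a \in s -> f a <= g a) ->
  \big[Rplus/0]_(a <- s) f a <= \big[Rplus/0]_(a <- s) g a.
Proof. by move=> h; rewrite big_seq [X in _ <= X]big_seq; exact: bigR_le. Qed.

Lemma bigR_ge0 (I : Type) (s : seq I) (P : pred I) (f : I -> R) :
  (forall a, P a -> 0 <= f a) -> 0 <= \big[Rplus/0]_(a <- s | P a) f a.
Proof. by move=> h; elim/big_rec: _ => [|a x Pa hx]; [lra|have := h a Pa; lra]. Qed.

Lemma bigR_distrr (I : Type) (s : seq I) (P : pred I) (c : R) (f : I -> R) :
  c * \big[Rplus/0]_(a <- s | P a) f a = \big[Rplus/0]_(a <- s | P a) (c * f a).
Proof.
apply: (big_morph (fun x => c * x)); [exact: Rmult_plus_distr_l|exact: Rmult_0_r].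
Qed.

Lemma bigC_distrr (I : Type) (s : seq I) (P : pred I) (c : C) (f : I -> C) :
  (c * \big[Cplus/RtoC 0]_(a <- s | P a) f a
   = \big[Cplus/RtoC 0]_(a <- s | P a) (c * f a))%C.
Proof.
apply: (big_morph (fun x => c * x)%C); [exact: Cmult_plus_distr_l|exact: Cmult_0_r].
Qed.

Lemma exp_INR (t : R) n : exp (INR n * t) = exp t ^ n.
Proof.
elim: n => [|n IH]; first by rewrite Rmult_0_l exp_0.
by rewrite S_INR /= -IH -exp_plus; f_equal; ring.
Qed.

(** Completing the square gives - a n^2 + b n <= (b+1)^2 / (4a) - n, a geometric majorant. *)
Lemma ex_series_gauss a b : 0 < a ->
  ex_series (fun n => exp (- a * (INR n * INR n) + b * INR n)).
Proof.
move=> a0; apply: (@ex_series_le R_AbsRing R_CompleteNormedModule _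
   (fun n => exp ((b + 1) * (b + 1) / (4 * a)) * exp (- 1) ^ n)).
  move=> n; rewrite /norm /= /abs /= Rabs_pos_eq; last by apply: Rlt_le; exact: exp_pos.
  rewrite -exp_INR -exp_plus; apply: exp_le.
  have := Rle_0_sqr (INR n - (b + 1) / (2 * a)).
  have e : a * Rsqr (INR n - (b + 1) / (2 * a))
    = a * (INR n * INR n) - (b + 1) * INR n + (b + 1) * (b + 1) / (4 * a).
    rewrite /Rsqr; field; lra.
  move=> h; have := Rmult_le_pos _ _ (Rlt_le _ _ a0) h; rewrite e; lra.
apply: (ex_series_scal_l (exp ((b + 1) * (b + 1) / (4 * a))) (fun n => exp (-1) ^ n)).
apply: ex_series_geom; rewrite Rabs_pos_eq; last by apply: Rlt_le; exact: exp_pos.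
rewrite -exp_0; apply: exp_increasing; lra.
Qed.

(** This class is stable under multiplication by exp (c |n|), the growth that occurs both in the
    q-binomial error and in the Lipschitz estimate of the bracket. *)
Definition gauss_bounded (f : Z -> R) := exists K a b, 0 <= K /\ 0 < a /\
  forall n, Rabs (f n) <= K * exp (- a * (IZR n * IZR n) + b * Rabs (IZR n)).

Lemma gauss_bounded_increments f : gauss_bounded f -> exists u : nat -> R,
  ex_series u /\ forall N, Rabs (f (Z.of_nat N.+1)) + Rabs (f (- Z.of_nat N.+1)%Z) <= u N.
Proof.
move=> [K [a [b [K0 [a0 h]]]]].
exists (fun N => 2 * K * exp (- a * (INR N.+1 * INR N.+1) + b * INR N.+1)); split.
  apply: (ex_series_scal_l (2 * K) (fun N => exp (- a * (INR N.+1 * INR N.+1) + b * INR N.+1))).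
  exact: ((ex_series_incr_1 _).1 (ex_series_gauss b a0)).
move=> N; have := h (Z.of_nat N.+1); have := h (- Z.of_nat N.+1)%Z.
rewrite opp_IZR -INR_IZR_INZ Rabs_Ropp (Rabs_pos_eq (INR _)); last exact: pos_INR.
rewrite Rmult_opp_opp; lra.
Qed.

Lemma gauss_bounded_rsumZ f : gauss_bounded f -> exists l : R, is_lim_seq (fun N => rsumZ N f) l.
Proof.
move=> /gauss_bounded_increments [u [hu h]].
apply: (ex_lim_of_increments (b := u)) => // N; rewrite rsumZS.
apply: Rle_trans (h N); apply: Rle_trans (Rabs_triang _ _).
by right; f_equal; ring.
Qed.

Lemma gauss_bounded_csumZ F : gauss_bounded (fun n => Cmod (F n)) ->
  exists l, Clim (fun N => csumZ N F) l.
Proof.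
move=> /gauss_bounded_increments [u [hu h]].
apply: (Clim_of_increments (b := u)) => // N; rewrite csumZS.
apply: Rle_trans (h N); rewrite !Rabs_pos_eq; try exact: Cmod_ge_0.
apply: Rle_trans (Cmod_triangle _ _).
by right; f_equal; ring.
Qed.

Lemma rsumZ_le_lim f (l : R) : (forall n, 0 <= f n) -> is_lim_seq (fun N => rsumZ N f) l ->
  forall N, rsumZ N f <= l.
Proof.
move=> f0 hl N; apply: (is_lim_seq_incr_compare _ _ hl) => M; rewrite rsumZS.
have := f0 (Z.of_nat M.+1); have := f0 (- Z.of_nat M.+1)%Z; lra.
Qed.

Lemma gauss_bounded_mul_exp f c : gauss_bounded f ->
  gauss_bounded (fun n => f n * exp (c * Rabs (IZR n))).
Proof.
move=> [K [a [b [K0 [a0 h]]]]]; exists K, a, (b + c); split=> //; split=> // n.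
rewrite Rabs_mult (Rabs_pos_eq (exp _)); last by apply: Rlt_le; exact: exp_pos.
rewrite (_ : _ + (b + c) * _ = (- a * (IZR n * IZR n) + b * Rabs (IZR n)) + c * Rabs (IZR n)); last by ring.
rewrite exp_plus -Rmult_assoc; apply: Rmult_le_compat_r => //.
by apply: Rlt_le; exact: exp_pos.
Qed.
End BigReal.

(** * The q-Pochhammer symbol *)

Lemma cprodS (N : nat) (F : nat -> C) : cprod (iota 0 N.+1) F = cprod (iota 0 N) F * F N.
Proof. by rewrite -addn1 iotaD cprod_cat add0n /= Cmult_1_r. Qed.

Lemma cprodSl (N : nat) (F : nat -> C) :
  cprod (iota 0 N.+1) F = F 0%N * cprod (iota 0 N) (fun j => F j.+1).
Proof. by rewrite /= (cprod_shift 1 0). Qed.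

Section QPochhammer.
Variable q : R.
Hypothesis q01 : (0 < q < 1)%R.

Lemma Cpow_n_R k : Cpow_n (RtoC q) k = RtoC (q ^ k).
Proof. by elim: k => //= k ->; rewrite RtoC_mult. Qed.

Lemma qpoch_partS z N :
  qpoch_part z (RtoC q) N.+1 = qpoch_part z (RtoC q) N * (1 - z * RtoC (q ^ N)).
Proof. by rewrite /qpoch_part cprodS Cpow_n_R. Qed.

Local Open Scope R_scope.

Lemma pow_q_gt0 N : 0 < q ^ N.
Proof. by apply: pow_lt; lra. Qed.

Lemma pow_q_le1 N : q ^ N <= 1.
Proof. by rewrite -(pow1 N); apply: pow_incr; lra. Qed.

Lemma ex_series_q c : ex_series (fun n => c * q ^ n).
Proof.
apply: (ex_series_scal_l c (fun n => q ^ n)); apply: ex_series_geom.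
rewrite Rabs_pos_eq; lra.
Qed.

(** Each factor satisfies |1 - y| <= exp |y|; the induction keeps the exact geometric sum of the
    exponents. *)
Lemma qpoch_part_bound z N : Cmod (qpoch_part z (RtoC q) N) <= exp (Cmod z / (1 - q)).
Proof.
have z0 := Cmod_ge_0 z.
apply: (Rle_trans _ (exp (Cmod z * ((1 - q ^ N) / (1 - q))))); last first.
  apply: exp_le; apply: Rmult_le_compat_l => //.
  rewrite -[X in _ <= X]Rmult_1_l; apply: Rmult_le_compat_r.
    by apply: Rlt_le; apply: Rinv_0_lt_compat; lra.
  by have := pow_q_gt0 N; lra.
elim: N => [|N IH].
  rewrite /qpoch_part /= Cmod_1 Rminus_diag /Rdiv Rmult_0_l Rmult_0_r exp_0; lra.
rewrite qpoch_partS Cmod_mult.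
have -> : Cmod z * ((1 - q ^ N.+1) / (1 - q))
   = Cmod z * ((1 - q ^ N) / (1 - q)) + Cmod z * q ^ N by rewrite /=; field; lra.
rewrite exp_plus; apply: Rmult_le_compat => //; try exact: Cmod_ge_0.
apply: Rle_trans (exp_ineq1_le _).
apply: Rle_trans (Cmod_triangle _ _) _.
rewrite Cmod_opp Cmod_mult Cmod_1 Cmod_R Rabs_pos_eq; first lra.
by apply: Rlt_le; exact: pow_q_gt0.
Qed.

(** [Lim_seq] is total, so [qpoch] is known to be the infinite product only after convergence is
    proved. *)
Lemma qpoch_cvg z : Clim (qpoch_part z (RtoC q)) (qpoch z (RtoC q)).
Proof.
have [|l hl] := @Clim_of_increments (qpoch_part z (RtoC q))
    (fun n => exp (Cmod z / (1 - q)) * Cmod z * q ^ n) _ (ex_series_q _).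
  move=> n; rewrite qpoch_partS.
  rewrite (_ : (qpoch_part z (RtoC q) n * (1 - z * RtoC (q ^ n)) - qpoch_part z (RtoC q) n)%C
    = (- (qpoch_part z (RtoC q) n * (z * RtoC (q ^ n))))%C); last by ring.
  rewrite Cmod_opp !Cmod_mult Cmod_R Rabs_pos_eq; last by apply: Rlt_le; exact: pow_q_gt0.
  rewrite Rmult_assoc; apply: Rmult_le_compat_r; last exact: qpoch_part_bound.
  by apply: Rmult_le_pos; [exact: Cmod_ge_0|apply: Rlt_le; exact: pow_q_gt0].
suff -> : qpoch z (RtoC q) = l by [].
rewrite /qpoch (is_lim_seq_unique _ _ (Clim_Re hl)) (is_lim_seq_unique _ _ (Clim_Im hl)).
by case: (l).
Qed.

Lemma qpoch_neq0 z : (forall k, (1 - z * RtoC (q ^ k))%C <> 0) -> qpoch z (RtoC q) <> 0.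
Proof.
move=> nz; have z0 := Cmod_ge_0 z.
(* From [K] on the moduli |z| q^k sum to at most 1/2; by prod (1 - b_k) >= 1 - sum b_k the remaining
   product keeps modulus at least 1/2. *)
have [K hK] : exists K, Cmod z * q ^ K / (1 - q) <= / 2.
  have aq : Rabs q < 1 by rewrite Rabs_pos_eq; lra.
  have y0 : 0 < (1 - q) / (2 * (Cmod z + 1)) by apply: Rdiv_lt_0_compat; lra.
  have [K hK] := pow_lt_1_zero q aq _ y0.
  exists K; have := hK K (le_n _); rewrite Rabs_pos_eq; last by apply: Rlt_le; exact: pow_q_gt0.
  move=> h; apply: (Rmult_le_reg_r (1 - q)); first lra.
  rewrite /Rdiv Rmult_assoc Rinv_l; last lra.
  rewrite Rmult_1_r.
  have h2 : q ^ K * (Cmod z + 1) <= (1 - q) / 2.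
    apply: (Rle_trans _ ((1 - q) / (2 * (Cmod z + 1)) * (Cmod z + 1))).
      by apply: Rmult_le_compat_r; lra.
    by right; field; lra.
  by have := pow_q_gt0 K; lra.
set pK := qpoch_part z (RtoC q) K.
have pK0 : 0 < Cmod pK.
  apply: (Cmod_gt_0 _).1; rewrite /pK; elim: (K) => [|M IH].
    by rewrite /qpoch_part /=; apply: RtoC_neq; lra.
  by rewrite qpoch_partS; apply: Cmult_neq_0.
have lower M : Cmod pK * (1 - Cmod z * q ^ K * ((1 - q ^ M) / (1 - q)))
    <= Cmod (qpoch_part z (RtoC q) (K + M)).
  elim: M => [|M IH].
    by rewrite addn0 /= -/pK; right; field; lra.
  rewrite addnS qpoch_partS Cmod_mult.
  have h1 : 1 - Cmod z * q ^ (K + M) <= Cmod (1 - z * RtoC (q ^ (K + M)))%C.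
    have := Cmod_triangle (1 - z * RtoC (q ^ (K + M)))%C (z * RtoC (q ^ (K + M)))%C.
    rewrite (_ : (1 - z * RtoC (q ^ (K + M)) + z * RtoC (q ^ (K + M)))%C = 1); last by ring.
    rewrite Cmod_1 Cmod_mult Cmod_R Rabs_pos_eq; first lra.
    by apply: Rlt_le; exact: pow_q_gt0.
  set A := Cmod z * q ^ K * ((1 - q ^ M) / (1 - q)).
  set b := Cmod z * q ^ (K + M).
  have q1 : 0 < / (1 - q) by apply: Rinv_0_lt_compat; lra.
  have zK : 0 <= Cmod z * q ^ K by apply: Rmult_le_pos => //; apply: Rlt_le; exact: pow_q_gt0.
  have A0 : 0 <= A.
    apply: Rmult_le_pos => //; apply: Rmult_le_pos; last lra.
    have := pow_q_le1 M; lra.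
  have b0 : 0 <= b by apply: Rmult_le_pos => //; apply: Rlt_le; exact: pow_q_gt0.
  have E : Cmod z * q ^ K * ((1 - q ^ M.+1) / (1 - q)) = A + b.
    rewrite /A /b (pow_add q K M) /=; field; lra.
  have Ab : A + b <= / 2.
    rewrite -E; apply: Rle_trans hK; rewrite /Rdiv -!Rmult_assoc.
    apply: Rmult_le_compat_r; first lra.
    rewrite -[X in _ <= X]Rmult_1_r; apply: Rmult_le_compat_l => //.
    have := pow_q_gt0 M.+1; lra.
  rewrite E.
  apply: (Rle_trans _ (Cmod pK * (1 - A) * (1 - b))).
    rewrite Rmult_assoc; apply: Rmult_le_compat_l; first lra.
    have := Rmult_le_pos _ _ A0 b0; lra.
  apply: Rmult_le_compat => //; try lra.
  by apply: Rmult_le_pos; lra.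
move=> e; have h := qpoch_cvg z; rewrite e in h.
have {}h : is_lim_seq (fun n => Cmod (qpoch_part z (RtoC q) n)) 0.
  by apply: is_lim_seq_ext h => n; congr Cmod; ring.
have {}h := (is_lim_seq_incr_n _ K _).1 h.
have : Rbar_le (Rbar.Finite (Cmod pK / 2)) (Rbar.Finite 0).
  apply: (is_lim_seq_le (fun=> Cmod pK / 2) _ _ _ _ (is_lim_seq_const _) h) => M.
  rewrite plusE addnC; apply: Rle_trans (lower M); rewrite /Rdiv.
  apply: Rmult_le_compat_l; first lra.
  have : Cmod z * q ^ K * ((1 - q ^ M) / (1 - q)) <= / 2.
    apply: Rle_trans hK; rewrite /Rdiv -!Rmult_assoc; apply: Rmult_le_compat_r.
      by apply: Rlt_le; apply: Rinv_0_lt_compat; lra.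
    rewrite -[X in _ <= X]Rmult_1_r; apply: Rmult_le_compat_l.
      by apply: Rmult_le_pos => //; apply: Rlt_le; exact: pow_q_gt0.
    have := pow_q_gt0 M; lra.
  lra.
rewrite /=; lra.
Qed.

Fixpoint qfact (M : nat) : R := if M is M'.+1 then qfact M' * (1 - q ^ M) else 1.

Lemma qpoch_part_qfact M : qpoch_part (RtoC q) (RtoC q) M = RtoC (qfact M).
Proof.
elim: M => [|M IH]; first by [].
by rewrite qpoch_partS IH -RtoC_mult -RtoC_minus -RtoC_mult.
Qed.

Lemma one_sub_pow_bounds M : 0 < 1 - q ^ M.+1 <= 1.
Proof.
have := pow_q_gt0 M.+1; have := pow_q_le1 M => h1 h2; split; last lra.
have : q * q ^ M <= q * 1 by apply: Rmult_le_compat_l; lra.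
rewrite /=; lra.
Qed.

Lemma qfact_bounds M : 0 < qfact M <= 1.
Proof.
elim: M => [|M IH]; first by rewrite /=; lra.
have h := one_sub_pow_bounds M; rewrite /qfact -/qfact; split.
  by apply: Rmult_lt_0_compat; lra.
by rewrite -[X in _ <= X]Rmult_1_l; apply: Rmult_le_compat; lra.
Qed.

(** As [qfact] is at most 1, one step decreases it by at most the next power of q; a geometric sum
    of these gives the rate. *)
Lemma qfact_limit : exists e : R, [/\ 0 < e, qpoch (RtoC q) (RtoC q) = RtoC e,
  (forall M, e <= qfact M) & forall M, qfact M - e <= q ^ M.+1 / (1 - q)].
Proof.
have hl := qpoch_cvg (RtoC q).
have nz : qpoch (RtoC q) (RtoC q) <> 0.
  apply: qpoch_neq0 => k; rewrite -RtoC_mult -RtoC_minus; apply: RtoC_neq.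
  have := one_sub_pow_bounds k; rewrite /=; lra.
have hr : is_lim_seq qfact (Re (qpoch (RtoC q) (RtoC q))).
  by apply: is_lim_seq_ext (Clim_Re hl) => n; rewrite qpoch_part_qfact.
have hi : Im (qpoch (RtoC q) (RtoC q)) = 0.
  have := is_lim_seq_unique _ _ (Clim_Im hl).
  rewrite (Lim_seq_ext _ (fun=> 0)); last by move=> n; rewrite qpoch_part_qfact.
  by rewrite Lim_seq_const => -[].
set e := Re _ in hr; exists e.
have E : qpoch (RtoC q) (RtoC q) = RtoC e.
  by apply: injective_projections.
have dec M : qfact M.+1 <= qfact M.
  have h := one_sub_pow_bounds M; have := qfact_bounds M => h2.
  by rewrite {1}/qfact -/qfact -[X in _ <= X]Rmult_1_r; apply: Rmult_le_compat_l; lra.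
have le_e M : e <= qfact M by apply: (is_lim_seq_decr_compare _ _ hr).
split=> //.
- have : Rbar_le (Rbar.Finite 0) (Rbar.Finite e).
    apply: (is_lim_seq_le (fun=> 0) _ _ _ _ (is_lim_seq_const _) hr) => n.
    have := qfact_bounds n; lra.
  case=> // h; case: nz; by rewrite E -h.
- move=> M.
  have inc j : qfact M - qfact (j + M)%N <= q ^ M.+1 * ((1 - q ^ j) / (1 - q)).
    elim: j => [|j IH]; first by rewrite add0n /= /Rdiv Rminus_diag; lra.
    have e1 : q ^ M.+1 * ((1 - q ^ j.+1) / (1 - q))
       = q ^ M.+1 * ((1 - q ^ j) / (1 - q)) + q ^ M.+1 * q ^ j by rewrite /=; field; lra.
    rewrite e1 addSn /qfact -/qfact.
    have e2 : q ^ (j + M).+1 = q ^ M.+1 * q ^ j by rewrite -pow_add plusE; f_equal; lia.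
    rewrite e2.
    have := qfact_bounds (j + M) => h2.
    have h3 : 0 < q ^ M.+1 * q ^ j by apply: Rmult_lt_0_compat; exact: pow_q_gt0.
    have : qfact (j + M) * (q ^ M.+1 * q ^ j) <= 1 * (q ^ M.+1 * q ^ j).
      by apply: Rmult_le_compat_r; lra.
    lra.
  have hM := (is_lim_seq_incr_n _ M _).1 hr.
  have : Rbar_le (Rbar.Finite (qfact M - q ^ M.+1 / (1 - q))) (Rbar.Finite e).
    apply: (is_lim_seq_le (fun=> _) _ _ _ _ (is_lim_seq_const _) hM) => j.
    have := inc j; rewrite plusE.
    have : q ^ M.+1 * ((1 - q ^ j) / (1 - q)) <= q ^ M.+1 / (1 - q).
      rewrite /Rdiv -Rmult_assoc; apply: Rmult_le_compat_r.
        by apply: Rlt_le; apply: Rinv_0_lt_compat; lra.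
      rewrite -[X in _ <= X]Rmult_1_r; apply: Rmult_le_compat_l.
        by apply: Rlt_le; exact: pow_q_gt0.
      have := pow_q_gt0 j; lra.
    lra.
  rewrite /=; lra.
Qed.
End QPochhammer.

(** * The triple product *)

Fixpoint qbin (q : R) (M j : nat) : R :=
  match j, M with
  | 0%N, _ => 1
  | _.+1, 0%N => 0
  | j'.+1, M'.+1 => q ^ j * qbin q M' j + qbin q M' j'
  end%R.

Lemma qbin_small q M j : (M < j)%N -> qbin q M j = 0%R.
Proof.
elim: M j => [|M IH] [|j] //= h.
by rewrite !IH ?Rmult_0_r ?Rplus_0_r //; lia.
Qed.

Lemma qbin_qfact q M j : (j <= M)%N ->
  (qbin q M j * (qfact q j * qfact q (M - j)) = qfact q M)%R.
Proof.
elim: M j => [|M IH] [|j] h //.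
- by rewrite /=; ring.
- by rewrite subn0 /=; ring.
- case: (ltngtP j M) => hj; last 2 first.
  + by exfalso; lia.
  + subst j; have := IH M (leqnn M); rewrite !subnn /= (@qbin_small q M M.+1) // => hM.
    transitivity (qbin q M M * (qfact q M * 1) * (1 - q * q ^ M))%R; first ring.
    by rewrite hM.
  + have h1 := IH j.+1 hj; have h2 := IH j (ltnW hj).
    have e1 : (M - j = (M - j.+1).+1)%N by lia.
    have e2 : (M.+1 - j.+1 = (M - j.+1).+1)%N by lia.
    rewrite e2; rewrite e1 in h2; set d := (M - j.+1)%N in h1 h2 *.
    have e3 : (q ^ M.+1 = q ^ j.+1 * q ^ d.+1)%R.
      by rewrite -pow_add; f_equal; rewrite /d plusE; lia.
    transitivity (qfact q M * (1 - q ^ M.+1))%R; last by [].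
    rewrite e3 /qbin -/qbin.
    (* The two weights q^(j+1) (1 - q^(d+1)) and 1 - q^(j+1) add up to 1 - q^(M+1). *)
    transitivity (q ^ j.+1 * (1 - q ^ d.+1) * (qbin q M j.+1 * (qfact q j.+1 * qfact q d))
      + (1 - q ^ j.+1) * (qbin q M j * (qfact q j * qfact q d.+1)))%R.
      rewrite /qfact -/qfact; ring.
    rewrite h1 h2; ring.
Qed.

Lemma big_iotaSl (N : nat) (F : nat -> C) :
  \big[Cplus/RtoC 0]_(j <- iota 0 N.+1) F j
  = F 0%N + \big[Cplus/RtoC 0]_(j <- iota 0 N) F j.+1.
Proof. by rewrite /= big_cons (iotaDl 1 0) big_map. Qed.

Lemma big_iotaSr (N : nat) (F : nat -> C) :
  \big[Cplus/RtoC 0]_(j <- iota 0 N.+1) F j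
  = \big[Cplus/RtoC 0]_(j <- iota 0 N) F j + F N.
Proof. by rewrite -addn1 iotaD big_cat big_seq1. Qed.

Lemma Cpow_n_mul a b k : Cpow_n (a * b) k = Cpow_n a k * Cpow_n b k.
Proof. by elim: k => [|k IH] /=; [|rewrite IH]; ring. Qed.

(** Removing the factor 1 + t leaves the same product at tq; the Pascal rule defining [qbin] is this
    recursion for the coefficients. *)
Lemma qbinomial_theorem (q : R) M t :
  cprod (iota 0 M) (fun k => 1 + t * RtoC (q ^ k))
  = \big[Cplus/RtoC 0]_(j <- iota 0 M.+1) (RtoC (qbin q M j * q ^ 'C(j, 2)) * Cpow_n t j).
Proof.
elim: M t => [|M IH] t.
  by rewrite big_seq1 /= Rmult_1_r Cmult_1_r.
rewrite cprodSl.
rewrite (@eq_cprod _ _ (fun k => 1 + t * RtoC q * RtoC (q ^ k))); last first.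
  by move=> k _; rewrite (_ : q ^ k.+1 = q * q ^ k)%R // RtoC_mult; ring.
rewrite IH [in RHS]big_iotaSl.
set X := fun j => RtoC (qbin q M j * q ^ 'C(j, 2)) * Cpow_n (t * RtoC q) j.
have E j : RtoC (qbin q M.+1 j.+1 * q ^ 'C(j.+1, 2)) * Cpow_n t j.+1 = X j.+1 + t * X j.
  rewrite /X (_ : qbin q M.+1 j.+1 = q * q ^ j * qbin q M j.+1 + qbin q M j)%R //.
  rewrite binS bin1 -plusE !Cpow_n_mul !Cpow_n_R (_ : q ^ j.+1 = q * q ^ j)%R //.
  rewrite pow_add (_ : Cpow_n t j.+1 = t * Cpow_n t j) // !RtoC_mult RtoC_plus !RtoC_mult.
  ring.
rewrite (eq_bigr _ (fun j _ => E j)) big_split /= -bigC_distrr.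
have -> : RtoC (qbin q M.+1 0 * q ^ 'C(0, 2)) * Cpow_n t 0 = X 0%N.
  by rewrite /X; case: (M).
rewrite Cplus_assoc -(big_iotaSl M.+1 X) big_iotaSr.
have -> : X M.+1 = 0 by rewrite /X qbin_small // Rmult_0_l Cmult_0_l.
rewrite -[Y in _ * Y = _]/(\big[Cplus/RtoC 0]_(j <- iota 0 M.+1) X j).
set S := bigop.body _ _ _; ring.
Qed.

Definition zsgn (a : Z) : C := if Z.even a then RtoC 1 else RtoC (-1).

Lemma zsgn_add a b : zsgn (a + b) = zsgn a * zsgn b.
Proof.
rewrite /zsgn Z.even_add; case: (Z.even a); case: (Z.even b); rewrite /= -RtoC_mult; congr RtoC; ring.
Qed.

Lemma zsgn_nat j : zsgn (Z.of_nat j) = Cpow_n (RtoC (-1)) j.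
Proof.
elim: j => [|j IH] //.
by rewrite Nat2Z.inj_succ -Z.add_1_r zsgn_add IH /= Cmult_comm.
Qed.

Lemma zsgn_opp a : zsgn (- a) = zsgn a.
Proof. by rewrite /zsgn Z.even_opp. Qed.

Lemma zsgn_sq a : zsgn a * zsgn a = 1.
Proof. by rewrite /zsgn; case: (Z.even a); rewrite -RtoC_mult; congr RtoC; ring. Qed.

Lemma Cmod_zsgn a : Cmod (zsgn a) = 1%R.
Proof. by rewrite /zsgn; case: (Z.even a); rewrite Cmod_R /Rabs; case: Rcase_abs; lra. Qed.

Lemma INR_bin2 j : (2 * INR 'C(j, 2) = INR j * (INR j - 1))%R.
Proof.
elim: j => [|j IH]; first by rewrite bin0n /=; ring.
by rewrite binS bin1 -plusE plus_INR Rmult_plus_distr_l IH S_INR; ring.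
Qed.

Lemma CmulNl (a b : C) : - a * b = - (a * b).
Proof. ring. Qed.

Definition theta_term (x : R) (r : nat) (u : C) : C :=
  xpow x (u * u / RtoC (INR r) - u).
Definition theta_summand (x : R) (r : nat) (u : C) (a : Z) : C :=
  zsgn a * theta_term x r (u + RtoC (INR r) * RtoC (IZR a)).

Section JacobiTripleProduct.
Variables (x : R) (r : nat).
Hypotheses (x01 : (0 < x < 1)%R) (r0 : (0 < r)%N).

Local Notation q := (x ^ (2 * r))%R.
Local Notation lam := (ln x).
Local Notation L := (RtoC (ln x)).
Local Notation rr := (RtoC (INR r)).

Lemma INR_r_gt0 : (0 < INR r)%R.
Proof. by apply: lt_0_INR; apply/ltP. Qed.

Lemma rr_neq0 : rr <> 0.
Proof. by apply: RtoC_neq; have := INR_r_gt0; lra. Qed.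

Lemma lam_lt0 : (lam < 0)%R.
Proof. by rewrite -ln_1; apply: ln_increasing; lra. Qed.

Lemma q_exp : q = exp (2 * INR r * lam).
Proof.
rewrite -[in LHS](exp_ln x); last lra.
by rewrite -exp_INR mult_INR.
Qed.

Lemma q01 : (0 < q < 1)%R.
Proof.
rewrite q_exp; split; first exact: exp_pos.
rewrite -exp_0; apply: exp_increasing.
have := INR_r_gt0; have := lam_lt0 => h1 h2.
have := Rmult_lt_0_compat _ _ (Ropp_0_gt_lt_contravar _ h1) h2; lra.
Qed.

Lemma q_pow k : RtoC (q ^ k) = cexp (RtoC (INR k) * (2 * rr * L)).
Proof.
rewrite q_exp -exp_INR -cexp_R; congr cexp.
by rewrite !RtoC_mult.
Qed.

Local Notation phi := (theta_term x r).
Local Notation psi := (theta_summand x r).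
Local Notation z u := (xpow x (2 * u)).

(** The factors are 1 - z q^(k-N) with k < N. Taking - z q^(k-N) out of each leaves 1 - q^(N-k) / z,
    the factors of the other Pochhammer symbol in reverse order. *)
Lemma reversed_product u N :
  cprod (iota 0 N) (fun k => 1 + - cexp (L * (2 * u - 2 * rr * RtoC (INR N))) * RtoC (q ^ k))
  = Cpow_n (RtoC (-1)) N * cexp (L * (2 * u * RtoC (INR N) - rr * RtoC (INR N * (INR N + 1))))
    * qpoch_part (RtoC q / z u) (RtoC q) N.
Proof.
elim: N => [|N IH].
  rewrite /qpoch_part /= Rmult_0_l (_ : L * _ = 0) ?cexp0; last by ring.
  ring.
rewrite cprodSl qpoch_partS.
rewrite (@eq_cprod _ _ (fun k => 1 + - cexp (L * (2 * u - 2 * rr * RtoC (INR N))) * RtoC (q ^ k))); last first.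
  move=> k _; rewrite !q_pow !CmulNl -!cexp_add !S_INR !RtoC_plus.
  by congr (1 + - cexp _); ring.
rewrite IH S_INR.
set P := qpoch_part _ _ _; set s := Cpow_n _ N.
have -> : Cpow_n (RtoC (-1)) N.+1 = - s by rewrite /= -/s; ring.
have -> : RtoC (q ^ 0) = 1 by [].
have -> : RtoC q / z u = cexp (2 * rr * L - L * (2 * u)).
  have := q_pow 1; rewrite pow_1 => ->.
  by rewrite /xpow /Cdiv -cexp_opp -cexp_add; congr cexp; rewrite /=; ring.
rewrite q_pow -cexp_add.
set A := cexp _; set B := cexp _; set D := cexp _; set E := cexp _.
have h1 : D = B * A.
  by rewrite /D /B /A -cexp_add; congr cexp; rewrite !RtoC_mult !RtoC_plus; ring.
have h2 : D * E = B.
  by rewrite /D /B /E -cexp_add; congr cexp; rewrite !RtoC_mult !RtoC_plus; ring.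
transitivity (s * (B - B * A) * P); first by ring.
rewrite -h1 -h2; ring.
Qed.

Lemma psi_shift u N j : psi u (Z.of_nat j - Z.of_nat N)
  = phi u * Cpow_n (RtoC (-1)) N
    * cexp (- (L * (2 * u * RtoC (INR N) - rr * RtoC (INR N * (INR N + 1)))))
    * (Cpow_n (RtoC (-1)) j
       * cexp (L * (rr * RtoC (INR j * (INR j - 1))
                    + RtoC (INR j) * (2 * u - 2 * rr * RtoC (INR N))))).
Proof.
rewrite /theta_summand /Z.sub zsgn_add zsgn_opp !zsgn_nat.
set s := Cpow_n _ N; set t := Cpow_n _ j.
transitivity (t * s * (phi u * cexp (- (L * (2 * u * RtoC (INR N) - rr * RtoC (INR N * (INR N + 1))))) *
   cexp (L * (rr * RtoC (INR j * (INR j - 1))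
                    + RtoC (INR j) * (2 * u - 2 * rr * RtoC (INR N)))))); last by ring.
congr (_ * _); rewrite /theta_term /xpow -!cexp_add; congr cexp.
rewrite plus_IZR opp_IZR -!INR_IZR_INZ !RtoC_mult !RtoC_minus !RtoC_plus.
field; exact: rr_neq0.
Qed.

(** The q-binomial theorem for 2N factors at t = - z q^(-N), with the summation index centred at N:
    a finite form of the Jacobi triple product. *)
Lemma finite_triple_product u N :
  phi u * (qpoch_part (z u) (RtoC q) N * qpoch_part (RtoC q / z u) (RtoC q) N)
  = csumZ N (fun a => RtoC (qbin q (N + N) (Z.to_nat (a + Z.of_nat N))) * psi u a).
Proof.
rewrite /csumZ big_map.
have E j : RtoC (qbin q (N + N) (Z.to_nat (Z.of_nat j - Z.of_nat N + Z.of_nat N)))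
   * psi u (Z.of_nat j - Z.of_nat N)
  = phi u * Cpow_n (RtoC (-1)) N
    * cexp (- (L * (2 * u * RtoC (INR N) - rr * RtoC (INR N * (INR N + 1)))))
    * (RtoC (qbin q (N + N) j * q ^ 'C(j, 2)) *
       Cpow_n (- cexp (L * (2 * u - 2 * rr * RtoC (INR N)))) j).
  rewrite Z.sub_add Nat2Z.id psi_shift.
  have -> : - cexp (L * (2 * u - 2 * rr * RtoC (INR N))) =
     RtoC (-1) * cexp (L * (2 * u - 2 * rr * RtoC (INR N))) by ring.
  rewrite Cpow_n_mul Cpow_cexp (RtoC_mult (qbin _ _ _)) q_pow.
  have -> : L * (rr * RtoC (INR j * (INR j - 1)) + RtoC (INR j) * (2 * u - 2 * rr * RtoC (INR N)))
    = RtoC (INR 'C(j, 2)) * (2 * rr * L) + RtoC (INR j) * (L * (2 * u - 2 * rr * RtoC (INR N))).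
    rewrite -INR_bin2 RtoC_mult; ring.
  rewrite cexp_add; ring.
rewrite (eq_bigr _ (fun j _ => E j)) {E} -bigC_distrr (mul2n N) -addnn -qbinomial_theorem.
rewrite iotaD cprod_cat reversed_product [(0 + N)%N]addnC (cprod_shift N 0).
rewrite (@eq_cprod _ _ (fun k => 1 - z u * Cpow_n (RtoC q) k)) -/(qpoch_part _ _ _); last first.
  move=> k _; rewrite Cpow_n_R /xpow !q_pow CmulNl -!cexp_add.
  by rewrite -plusE plus_INR RtoC_plus; congr (1 + - cexp _); ring.
set A := cexp (- _); set B := cexp (L * _ ).
have AB : A * B = 1.
  by rewrite /A /B -cexp_add -cexp0; congr cexp; ring.
have s2 : Cpow_n (RtoC (-1)) N * Cpow_n (RtoC (-1)) N = 1.
  by rewrite -zsgn_nat zsgn_sq.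
set P1 := qpoch_part _ _ _; set P2 := qpoch_part _ _ _; set s := Cpow_n _ N in s2 *.
transitivity (phi u * (P1 * P2) * (A * B) * (s * s)); last by ring.
rewrite AB s2; ring.
Qed.
End JacobiTripleProduct.

Lemma re_scal (a : R) (z : C) : Re (RtoC a * z) = (a * Re z)%R.
Proof. by case: z => b c /=; ring. Qed.

(** * The bracket as a theta series *)

Section SeriesForm.
Variables (x : R) (r : nat).
Hypotheses (x01 : (0 < x < 1)%R) (r0 : (0 < r)%N).
Local Notation q := (x ^ (2 * r))%R.
Local Notation lam := (ln x).
Local Notation L := (RtoC (ln x)).
Local Notation rr := (RtoC (INR r)).
Local Notation phi := (theta_term x r).
Local Notation psi := (theta_summand x r).
Local Notation z u := (xpow x (2 * u)).
Local Open Scope R_scope.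

Lemma gauss_bounded_exp_quadratic K a b : 0 <= K -> 0 < a ->
  gauss_bounded (fun n => K * exp (- a * (IZR n * IZR n) + b * IZR n)).
Proof.
move=> K0 a0; exists K, a, (Rabs b); split=> //; split=> // n.
have e0 := exp_pos (- a * (IZR n * IZR n) + b * IZR n).
rewrite Rabs_pos_eq; last by apply: Rmult_le_pos; lra.
apply: Rmult_le_compat_l => //; apply: exp_le; apply: Rplus_le_compat_l.
rewrite -Rabs_mult; exact: Rle_abs.
Qed.

Lemma gauss_bounded_ext f g : (forall n, f n = g n) -> gauss_bounded f -> gauss_bounded g.
Proof.
move=> h [K [a [b [K0 [a0 H]]]]]; exists K, a, b; split=> //; split=> // n; rewrite -h; exact: H.
Qed.

Lemma Cmod_theta_summand u a : Cmod (psi u a)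
  = exp (lam * Re (u * u / rr - u)%C)
    * exp (- (- lam * INR r) * (IZR a * IZR a) + lam * (2 * Re u - INR r) * IZR a).
Proof.
rewrite Cmod_mult Cmod_zsgn Rmult_1_l Cmod_cexp -exp_plus; f_equal.
rewrite (_ : (L * _)%C = (L * ((u * u / rr - u) + (RtoC (2 * IZR a) * u
   + RtoC (INR r * (IZR a * IZR a) - INR r * IZR a))))%C); last first.
  by rewrite !RtoC_mult RtoC_minus !RtoC_mult; field; exact: rr_neq0.
rewrite re_scal !re_plus re_scal /=; ring.
Qed.

Lemma gauss_bounded_theta_summand u : gauss_bounded (fun a => Cmod (psi u a)).
Proof.
apply: (gauss_bounded_ext (fun n => esym (Cmod_theta_summand u n))).
apply: gauss_bounded_exp_quadratic; first by apply: Rlt_le; exact: exp_pos.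
apply: Rmult_lt_0_compat; [have := lam_lt0 x01; lra|exact: INR_r_gt0].
Qed.

(* Here [e] is the limit of [qfact q], so [/ e] is the limit of the central
   q-binomial coefficients. *)
Lemma qbin_estimate e N a : 0 < e ->
  (forall M, e <= qfact q M) -> (forall M, qfact q M - e <= q ^ M.+1 / (1 - q)) ->
  (- Z.of_nat N <= a <= Z.of_nat N)%Z ->
  Rabs (qbin q (N + N) (Z.to_nat (a + Z.of_nat N)) - / e)
  <= 2 / (e * e * e * (1 - q)) * (q ^ N * exp (- ln q * Rabs (IZR a))).
Proof.
move=> e0 he hd ha; have [q0 q1] := q01 x01 r0.
set j := Z.to_nat _; have hj : (j <= N + N)%N by rewrite /j; lia.
have hb := qbin_qfact q hj.
set d := (N + N - j)%N in hb.
(* The three [qfact] indices 2N, N + a and N - a are all at least N - |a|, so each value lies within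
   [eta] of its limit [e]. *)
pose m := (N - Z.abs_nat a)%N.
have pos M : 0 < q ^ M by apply: pow_lt.
have mono M : (m <= M)%N -> q ^ M.+1 / (1 - q) <= q ^ m / (1 - q).
  move=> h; apply: Rmult_le_compat_r; first by apply: Rlt_le; apply: Rinv_0_lt_compat; lra.
  have -> : M.+1 = ((M.+1 - m) + m)%N by lia.
  rewrite -plusE pow_add -[X in _ <= X]Rmult_1_l; apply: Rmult_le_compat_r; first by have := pos m; lra.
  by rewrite -(pow1 (M.+1 - m)); apply: pow_incr; lra.
have key : q ^ m = q ^ N * exp (- ln q * Rabs (IZR a)).
  have -> : Rabs (IZR a) = INR (Z.abs_nat a).
    by rewrite INR_IZR_INZ Zabs2Nat.id_abs abs_IZR.
  have -> : N = (m + Z.abs_nat a)%N by rewrite /m; lia.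
  have kq : q ^ Z.abs_nat a = exp (INR (Z.abs_nat a) * ln q) by rewrite exp_INR exp_ln.
  rewrite -plusE pow_add Rmult_assoc kq -exp_plus (_ : _ + _ = 0) ?exp_0; ring.
rewrite -key; set eta := q ^ m / (1 - q) in mono *.
have bd M : (m <= M)%N -> e <= qfact q M <= e + eta.
  move=> h; have := he M; have := hd M; have := mono M h; lra.
have hA := bd (N + N)%N ltac:(rewrite /m; lia).
have hB := bd j ltac:(rewrite /m /j; lia).
have hD := bd d ltac:(rewrite /m /d /j; lia).
have le1 M : qfact q M <= 1 by have := qfact_bounds (conj q0 q1) M; lra.
move: (qfact q (N + N)) (qfact q j) (qfact q d) hA hB hD (le1 (N + N)%N) (le1 j) (le1 d) hb
  => A B D hA hB hD A1 B1 D1 hb.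
have BD0 : 0 < B * D by apply: Rmult_lt_0_compat; lra.
have -> : qbin q (N + N) j = A / (B * D) by rewrite -hb; field; lra.
have -> : A / (B * D) - / e = (e * (A - B) + B * (e - D)) * / (e * (B * D)) by field; lra.
have -> : 2 / (e * e * e * (1 - q)) * q ^ m = (2 * eta) * / (e * (e * e)).
  by rewrite /eta; field; lra.
have eta0 : 0 <= eta by lra.
have eBD : 0 < e * (B * D) by apply: Rmult_lt_0_compat.
rewrite Rabs_mult (Rabs_pos_eq (/ _)); last by apply: Rlt_le; apply: Rinv_0_lt_compat.
apply: Rmult_le_compat; first exact: Rabs_pos.
- by apply: Rlt_le; apply: Rinv_0_lt_compat.
- apply: Rle_trans (Rabs_triang _ _) _; rewrite !Rabs_mult (Rabs_pos_eq e) ?(Rabs_pos_eq B); try lra.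
  have h1 : Rabs (A - B) <= eta by apply: Rabs_le; lra.
  have h2 : Rabs (e - D) <= eta by apply: Rabs_le; lra.
  have k1 : e * Rabs (A - B) <= 1 * eta by apply: Rmult_le_compat; try lra; exact: Rabs_pos.
  have k2 : B * Rabs (e - D) <= 1 * eta by apply: Rmult_le_compat; try lra; exact: Rabs_pos.
  lra.
- apply: Rinv_le_contravar; first by apply: Rmult_lt_0_compat => //; apply: Rmult_lt_0_compat.
  apply: Rmult_le_compat_l; first lra.
  apply: Rmult_le_compat; lra.
Qed.

(** The two sides of [finite_triple_product] give two values for one limit. On the right the
    coefficients tend to [/ e], with an error summable against the Gaussian terms; the factor
    (q;q)_oo in [Theta] is [e] and cancels it. *)
Theorem brk_series u : Clim (fun N => csumZ N (psi u)) (brk x r u).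
Proof.
have [q0 q1] := q01 x01 r0.
have [S hS] := gauss_bounded_csumZ (gauss_bounded_theta_summand u).
have [e [e0 ee he hd]] := qfact_limit (conj q0 q1).
have P : Clim (fun N => phi u * (qpoch_part (z u) (RtoC q) N * qpoch_part (RtoC q / z u) (RtoC q) N))%C
   (phi u * (qpoch (z u) (RtoC q) * qpoch (RtoC q / z u) (RtoC q)))%C.
  apply: Clim_cmul; apply: Clim_mul; exact: qpoch_cvg (conj q0 q1) _.
have [l hl] := gauss_bounded_rsumZ (gauss_bounded_mul_exp (- ln q) (gauss_bounded_theta_summand u)).
have Q : Clim (fun N => phi u * (qpoch_part (z u) (RtoC q) N * qpoch_part (RtoC q / z u) (RtoC q) N))%C
   (RtoC (/ e) * S)%C.
  apply: (Clim_diff (Clim_cmul (RtoC (/ e)) hS)).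
  set c := 2 / (e * e * e * (1 - q)).
  have c0 : 0 <= c.
    apply: Rlt_le; apply: Rdiv_lt_0_compat; first lra.
    by apply: Rmult_lt_0_compat; last lra; do 2 apply: Rmult_lt_0_compat => //.
  apply: (Clim_squeeze (e := fun N => c * l * q ^ N)); last first.
    rewrite (_ : Rbar.Finite 0 = Rbar.Finite (c * l * 0)); last by f_equal; ring.
    apply: is_lim_seq_mult'; first exact: is_lim_seq_const.
    by apply: is_lim_seq_geom; rewrite Rabs_pos_eq; lra.
  move=> N; rewrite finite_triple_product // /csumZ bigC_distrr.
  set s := zs N.
  have -> : (\big[Cplus/RtoC 0]_(a <- s) (RtoC (qbin q (N + N) (Z.to_nat (a + Z.of_nat N))) * psi u a)
      - \big[Cplus/RtoC 0]_(a <- s) (RtoC (/ e) * psi u a) - 0)%C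
    = \big[Cplus/RtoC 0]_(a <- s) (RtoC (qbin q (N + N) (Z.to_nat (a + Z.of_nat N)) - / e) * psi u a)%C.
    rewrite [RHS](eq_bigr (fun a => RtoC (qbin q (N + N) (Z.to_nat (a + Z.of_nat N))) * psi u a
      + RtoC (-1) * (RtoC (/ e) * psi u a))%C); last by move=> a _; rewrite RtoC_minus; ring.
    rewrite big_split /= -(bigC_distrr _ _ (RtoC (-1))); ring.
  apply: Rle_trans (Cmod_bigC _ _ _) _.
  apply: (Rle_trans _ (\big[Rplus/0]_(a <- s) (c * q ^ N * (Cmod (psi u a) * exp (- ln q * Rabs (IZR a)))))).
    apply: bigR_le_seq => a /mem_zs ha; rewrite Cmod_mult Cmod_R.
    have := qbin_estimate e0 he hd ha; rewrite -/c => h.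
    rewrite (_ : c * q ^ N * _ = c * (q ^ N * exp (- ln q * Rabs (IZR a))) * Cmod (psi u a)); last by ring.
    by apply: Rmult_le_compat_r; first exact: Cmod_ge_0.
  rewrite -bigR_distrr -/(rsumZ N _).
  rewrite (_ : c * l * q ^ N = c * q ^ N * l); last by ring.
  apply: Rmult_le_compat_l.
    by apply: Rmult_le_pos => //; apply: Rlt_le; apply: pow_lt.
  apply: (rsumZ_le_lim _ hl) => a; apply: Rmult_le_pos; first exact: Cmod_ge_0.
  by apply: Rlt_le; exact: exp_pos.
have E := Clim_unique P Q.
suff -> : brk x r u = S by [].
rewrite /brk /Theta ee.
transitivity (RtoC e * (phi u * (qpoch (z u) (RtoC q) * qpoch (RtoC q / z u) (RtoC q))))%C.
  rewrite /theta_term; ring.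
rewrite E Cmult_assoc -RtoC_mult Rinv_r; [ring|lra].
Qed.
End SeriesForm.

(** * The three-term identity for the bracket *)

Lemma big_uniq_sub (R : Type) (idx : R) (op : Monoid.com_law idx) (I : eqType)
    (s1 s2 : seq I) (F : I -> R) : uniq s1 -> uniq s2 -> {subset s1 <= s2} ->
  \big[op/idx]_(a <- s2) F a
  = op (\big[op/idx]_(a <- s1) F a) (\big[op/idx]_(a <- s2 | a \notin s1) F a).
Proof.
move=> u1 u2 h; rewrite (bigID (mem s1)) /=; congr (op _ _).
rewrite -big_filter; apply: perm_big; apply: uniq_perm => //.
  exact: filter_uniq.
move=> a; rewrite mem_filter; apply/andP/idP => [[]//|ha]; split=> //; exact: h.
Qed.

(** With [s1] and [s3] boxes, the bound is a difference of products of convergent partial sums,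
    hence tends to zero; this justifies regrouping the double series by parity. *)
Lemma sum_sandwich (I : eqType) (s1 s2 s3 : seq I) (T : I -> C) :
  uniq s1 -> uniq s2 -> uniq s3 -> {subset s1 <= s2} -> {subset s2 <= s3} ->
  (Cmod (\big[Cplus/RtoC 0]_(a <- s2) T a - \big[Cplus/RtoC 0]_(a <- s1) T a)%C
   <= \big[Rplus/0]_(a <- s3) Cmod (T a) - \big[Rplus/0]_(a <- s1) Cmod (T a))%R.
Proof.
move=> u1 u2 u3 h12 h23.
rewrite (@big_uniq_sub C _ Cplus _ _ _ T u1 u2 h12) /=.
rewrite (@big_uniq_sub R _ Rplus _ _ _ (fun a => Cmod (T a)) u2 u3 h23) /=.
rewrite (@big_uniq_sub R _ Rplus _ _ _ (fun a => Cmod (T a)) u1 u2 h12) /=.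
have h := Cmod_bigC s2 [pred a | a \notin s1] T.
have h' := bigR_ge0 s3 (P := fun a => a \notin s2) (f := fun a => Cmod (T a)) (fun a _ => Cmod_ge_0 _).
rewrite (_ : (_ + _ - _)%C = \big[Cplus/RtoC 0]_(a <- s2 | a \notin s1) T a); last by ring.
rewrite /= in h; lra.
Qed.

Lemma csumZ_mul N F G :
  csumZ N F * csumZ N G = \big[Cplus/RtoC 0]_(a <- zs N) \big[Cplus/RtoC 0]_(b <- zs N) (F a * G b).
Proof.
rewrite Cmult_comm bigC_distrr; apply: eq_bigr => a _.
by rewrite Cmult_comm bigC_distrr.
Qed.

Lemma rsumZ_mul N f g : (rsumZ N f * rsumZ N g
  = \big[Rplus/0]_(a <- zs N) \big[Rplus/0]_(b <- zs N) (f a * g b))%R.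
Proof.
rewrite Rmult_comm bigR_distrr; apply: eq_bigr => a _.
by rewrite Rmult_comm bigR_distrr.
Qed.

Definition box N : seq (Z * Z) := [seq (a, b) | a <- zs N, b <- zs N].
(** Index pairs of equal parity, parametrised so that the summand factors into a function of t and
    one of d; [odds] does the same for opposite parity. *)
Definition evens N : seq (Z * Z) := [seq ((t + d)%Z, (t - d)%Z) | t <- zs N, d <- zs N].
Definition odds N : seq (Z * Z) := [seq ((t + d)%Z, (t + 1 - d)%Z) | t <- zs N, d <- zs N].

Lemma mem_box N a b : ((a, b) \in box N) <->
  (- Z.of_nat N <= a <= Z.of_nat N /\ - Z.of_nat N <= b <= Z.of_nat N)%Z.
Proof.
split.
  by move=> /allpairsP[[a' b'] /= [/mem_zs ha /mem_zs hb [-> ->]]].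
move=> [ha hb]; apply/allpairsP; exists (a, b); split=> //; exact/mem_zs.
Qed.

Lemma box_uniq N : uniq (box N).
Proof. by apply: allpairs_uniq; try exact: zs_uniq; case=> [a b] [c d]. Qed.

Lemma lattice_uniq N : uniq (evens N ++ odds N).
Proof.
rewrite cat_uniq; apply/and3P; split.
- apply: allpairs_uniq; try exact: zs_uniq.
  by case=> [a b] [c d] _ _ [h1 h2]; congr pair; lia.
- apply/hasPn => -[a b] /allpairsP[[t d] /= [_ _ [-> ->]]].
  apply/negP => /allpairsP[[t' d'] /= [_ _ [h1 h2]]]; lia.
- apply: allpairs_uniq; try exact: zs_uniq.
  by case=> [a b] [c d] _ _ [h1 h2]; congr pair; lia.
Qed.

Lemma box_sub_lattice N : {subset box N <= evens N ++ odds N}.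
Proof.
case=> a b /mem_box [ha hb]; rewrite mem_cat; apply/orP.
case: (Z.Even_or_Odd (a + b)) => [[t ht]|[t ht]]; [left|right];
  apply/allpairsP; exists (t, (a - t)%Z); 
  (split; [apply/mem_zs => /=; lia|apply/mem_zs => /=; lia|congr pair => /=; lia]).
Qed.

Lemma lattice_sub_box N : {subset evens N ++ odds N <= box (2 * N).+1}.
Proof.
case=> a b; rewrite mem_cat => /orP[] /allpairsP[[t d] /= [/mem_zs ht /mem_zs hd [-> ->]]];
apply/mem_box; lia.
Qed.

Definition Climval (f : nat -> C) : C :=
  (real (Lim_seq (fun n => Re (f n))), real (Lim_seq (fun n => Im (f n)))).

Lemma ClimvalP f : (exists l, Clim f l) -> Clim f (Climval f).
Proof.
move=> [l hl]; suff -> : Climval f = l by [].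
rewrite /Climval (is_lim_seq_unique _ _ (Clim_Re hl)) (is_lim_seq_unique _ _ (Clim_Im hl)).
by case: (l).
Qed.

(** * Product formula, zeros and oddness of the bracket *)

Section BracketProperties.
Variables (x : R) (r : nat).
Hypotheses (x01 : (0 < x < 1)%R) (r0 : (0 < r)%N).
Local Notation q := (x ^ (2 * r))%R.
Local Notation lam := (ln x).
Local Notation L := (RtoC (ln x)).
Local Notation rr := (RtoC (INR r)).
Local Notation phi := (theta_term x r).
Local Notation psi := (theta_summand x r).

(** The term x^(2 (u + r d)^2 / r) of a theta series without signs. In the determinant of the
    overview G is [even_theta] and F is its translate by -r/2. *)
Definition even_theta_summand (u : C) (d : Z) : C :=
  cexp (L * (2 * ((u + rr * RtoC (IZR d)) * (u + rr * RtoC (IZR d))) / rr)).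
Local Notation gam := even_theta_summand.
Definition even_theta (u : C) : C := Climval (fun N => csumZ N (gam u)).

Lemma Cmod_even_theta_summand u d : (Cmod (gam u d)
  = exp (lam * Re (2 * (u * u) / rr)%C)
    * exp (- (- (2 * lam) * INR r) * (IZR d * IZR d) + lam * (4 * Re u) * IZR d))%R.
Proof.
rewrite Cmod_cexp -exp_plus; f_equal.
rewrite (_ : (L * _)%C = (L * ((2 * (u * u) / rr) + (RtoC (4 * IZR d) * u
   + RtoC (2 * INR r * (IZR d * IZR d)))))%C); last first.
  by rewrite (RtoC_mult 4) (RtoC_mult (2 * INR r)) (RtoC_mult 2) (RtoC_mult (IZR d)); field; exact: rr_neq0.
rewrite re_scal !re_plus re_scal /=; ring.
Qed.

Lemma even_theta_series u : Clim (fun N => csumZ N (gam u)) (even_theta u).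
Proof.
apply: ClimvalP; apply: gauss_bounded_csumZ.
apply: (gauss_bounded_ext (fun n => esym (Cmod_even_theta_summand u n))).
apply: gauss_bounded_exp_quadratic; first by apply: Rlt_le; exact: exp_pos.
apply: Rmult_lt_0_compat; [have := lam_lt0 x01; lra|exact: INR_r_gt0].
Qed.

(** For the two arguments A and B, A^2 + B^2 = ((A+B)^2 + (A-B)^2) / 2 separates t from d.
    Completing the square with the linear term -(A+B) produces the translate by r/2 and the constant
    x^(-r/2). *)
Lemma theta_summand_even X Y t d :
  psi (X + Y) (t + d) * psi (X - Y) (t - d)
  = cexp (- (L * rr / 2)) * (gam (X - rr / 2) t * gam Y d).
Proof.
rewrite /theta_summand /theta_term /xpow /gam.
transitivity (zsgn (t + d) * zsgn (t - d) *
   (cexp (L * ((X + Y + rr * RtoC (IZR (t + d))) * (X + Y + rr * RtoC (IZR (t + d))) / rr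
           - (X + Y + rr * RtoC (IZR (t + d)))))
   * cexp (L * ((X - Y + rr * RtoC (IZR (t - d))) * (X - Y + rr * RtoC (IZR (t - d))) / rr
           - (X - Y + rr * RtoC (IZR (t - d))))))); first by ring.
rewrite -zsgn_add (_ : (t + d + (t - d) = t + t)%Z); last by lia.
rewrite zsgn_add zsgn_sq -!cexp_add Cmult_1_l; congr cexp.
rewrite plus_IZR minus_IZR RtoC_minus RtoC_plus; field; exact: rr_neq0.
Qed.

(** The additional 1 moves half the sum of the arguments by r/2, cancelling the translate at X, and
    half their difference by -r/2, creating one at Y. Opposite parities give the sign. *)
Lemma theta_summand_odd X Y t d :
  psi (X + Y) (t + d) * psi (X - Y) (t + 1 - d)
  = - (cexp (- (L * rr / 2)) * (gam X t * gam (Y - rr / 2) d)).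
Proof.
rewrite /theta_summand /theta_term /xpow /gam.
transitivity (zsgn (t + d) * zsgn (t + 1 - d) *
   (cexp (L * ((X + Y + rr * RtoC (IZR (t + d))) * (X + Y + rr * RtoC (IZR (t + d))) / rr
           - (X + Y + rr * RtoC (IZR (t + d)))))
   * cexp (L * ((X - Y + rr * RtoC (IZR (t + 1 - d))) * (X - Y + rr * RtoC (IZR (t + 1 - d))) / rr
           - (X - Y + rr * RtoC (IZR (t + 1 - d))))))); first by ring.
rewrite -zsgn_add (_ : (t + d + (t + 1 - d) = t + t + 1)%Z); last by lia.
rewrite !zsgn_add zsgn_sq -!cexp_add Cmult_1_l.
have -> : zsgn 1 = - (1) by rewrite /zsgn /=; rewrite -RtoC_opp.
rewrite CmulNl Cmult_1_l; congr (- cexp _).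
rewrite minus_IZR !plus_IZR RtoC_minus !RtoC_plus; field; exact: rr_neq0.
Qed.

Theorem brk_product X Y : brk x r (X + Y) * brk x r (X - Y)
  = cexp (- (L * rr / 2)) * (even_theta (X - rr / 2) * even_theta Y
                             - even_theta X * even_theta (Y - rr / 2)).
Proof.
set c := cexp _.
have h1 := Clim_mul (brk_series x01 r0 (X + Y)) (brk_series x01 r0 (X - Y)).
have h2 := Clim_cmul c (Clim_sub (Clim_mul (even_theta_series (X - rr / 2)) (even_theta_series Y))
   (Clim_mul (even_theta_series X) (even_theta_series (Y - rr / 2)))).
suff h3 : Clim (fun N => c * (csumZ N (gam (X - rr / 2)) * csumZ N (gam Y)
       - csumZ N (gam X) * csumZ N (gam (Y - rr / 2)))) (brk x r (X + Y) * brk x r (X - Y)).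
  exact: Clim_unique h3 h2.
apply: (Clim_diff h1).
have [A hA] := gauss_bounded_rsumZ (gauss_bounded_theta_summand x01 r0 (X + Y)).
have [B hB] := gauss_bounded_rsumZ (gauss_bounded_theta_summand x01 r0 (X - Y)).
set f := fun a => Cmod (psi (X + Y) a) in hA.
set g := fun a => Cmod (psi (X - Y) a) in hB.
pose T (p : Z * Z) := psi (X + Y) p.1 * psi (X - Y) p.2.
have boxC N : csumZ N (psi (X + Y)) * csumZ N (psi (X - Y)) = \big[Cplus/RtoC 0]_(p <- box N) T p.
  by rewrite csumZ_mul /box big_allpairs.
have boxR N : (rsumZ N f * rsumZ N g)%R = \big[Rplus/0%R]_(p <- box N) Cmod (T p).
  rewrite rsumZ_mul /box big_allpairs; apply: eq_bigr => a _; apply: eq_bigr => b _.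
  by rewrite /T Cmod_mult.
apply: (Clim_squeeze (e := fun N => (rsumZ (2 * N).+1 f * rsumZ (2 * N).+1 g - rsumZ N f * rsumZ N g)%R)).
  move=> N; rewrite boxC !boxR.
  have -> : c * (csumZ N (gam (X - rr / 2)) * csumZ N (gam Y) - csumZ N (gam X) * csumZ N (gam (Y - rr / 2)))
     = \big[Cplus/RtoC 0]_(p <- evens N ++ odds N) T p.
    rewrite big_cat /evens /odds !big_allpairs_dep !csumZ_mul.
    transitivity (c * \big[Cplus/RtoC 0]_(a <- zs N) \big[Cplus/RtoC 0]_(b <- zs N) (gam (X - rr / 2) a * gam Y b)
     + - c * \big[Cplus/RtoC 0]_(a <- zs N) \big[Cplus/RtoC 0]_(b <- zs N) (gam X a * gam (Y - rr / 2) b)); first by ring.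
    rewrite !bigC_distrr; congr (_ + _); apply: eq_bigr => a _; rewrite bigC_distrr; apply: eq_bigr => b _.
      by rewrite /T /= theta_summand_even.
    by rewrite /T /= theta_summand_odd CmulNl.
  rewrite (_ : (_ - _ - RtoC 0)%C = \big[Cplus/RtoC 0]_(p <- evens N ++ odds N) T p
     - \big[Cplus/RtoC 0]_(p <- box N) T p); last by ring.
  apply: sum_sandwich; [exact: box_uniq|exact: lattice_uniq|exact: box_uniq
    |exact: box_sub_lattice|exact: lattice_sub_box].
have sub u l : is_lim_seq u (Rbar.Finite l) -> is_lim_seq (fun N => u (2 * N).+1) (Rbar.Finite l).
  move=> h; apply: (is_lim_seq_subseq u _ (fun N => (2 * N).+1) _ h).
  by apply: eventually_subseq => n; lia.
rewrite (_ : Rbar.Finite 0 = Rbar.Finite (A * B - A * B)); last by f_equal; ring.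
apply: is_lim_seq_minus'; apply: is_lim_seq_mult' => //.
- exact: (sub (fun N => rsumZ N f)).
- exact: (sub (fun N => rsumZ N g)).
Qed.

Theorem brk_three_term : three_term (brk x r).
Proof. move=> a b c d; rewrite !brk_product; ring. Qed.

(** A factor 1 - y can vanish only if |y| = 1; for the factors involving u this forces Re u to be a
    multiple of r. *)
Theorem brk_neq0 u : (forall k : Z, Re u <> IZR k * INR r)%R -> brk x r u <> 0.
Proof.
move=> h; have q1 := q01 x01 r0.
have rp := INR_r_gt0 r0; have l0 := lam_lt0 x01.
have Cz : Cmod (xpow x (2 * u)) = exp (lam * (2 * Re u)).
  by rewrite Cmod_cexp re_scal; f_equal; rewrite re_scal.
have zn : xpow x (2 * u) <> 0 by exact: cexp_neq0.
have Cq k : Cmod (RtoC (q ^ k)) = exp (INR k * (2 * INR r * lam)).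
  rewrite Cmod_R Rabs_pos_eq; last by apply: Rlt_le; apply: pow_lt; lra.
  by rewrite exp_INR q_exp.
have unit w : 1 - w = 0 -> Cmod w = 1%R.
  move=> e; have -> : w = 1 - (1 - w) by ring.
  rewrite e (_ : 1 - 0 = 1) ?Cmod_1 //; ring.
rewrite /brk /Theta; apply: Cmult_neq_0; first exact: cexp_neq0.
apply: Cmult_neq_0; [apply: Cmult_neq_0|]; apply: qpoch_neq0 => // k /unit;
  rewrite !Cmod_mult ?Cz Cq.
- rewrite -exp_plus -exp_0 => /exp_inv e; apply: (h (- Z.of_nat k)%Z).
  rewrite opp_IZR -INR_IZR_INZ; apply: (Rmult_eq_reg_l (2 * lam)); lra.
- rewrite -{1}[q]pow_1 Cq Cmod_inv // Cz -exp_Ropp -!exp_plus -exp_0 => /exp_inv e.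
  apply: (h (Z.of_nat k.+1)).
  rewrite -INR_IZR_INZ S_INR; apply: (Rmult_eq_reg_l (2 * lam)); last by lra.
  by rewrite /= in e; lra.
- rewrite -{1}[q]pow_1 Cq -!exp_plus -exp_0 => /exp_inv e.
  rewrite /= in e; have := pos_INR k => k0.
  have : (0 < (INR k + 1) * (2 * INR r * - lam))%R.
    by apply: Rmult_lt_0_compat; [lra|apply: Rmult_lt_0_compat; lra].
  lra.
Qed.

(** Interchanging X and Y negates the determinant in [brk_product] and replaces [X-Y] by [Y-X]. With
    X + Y = r/2 the other bracket is nonzero and cancels. *)
Theorem brk_odd u : brk x r (- u) = - brk x r u.
Proof.
have rp := INR_r_gt0 r0.
pose v := RtoC (INR r / 2).
have nv : brk x r v <> 0.
  apply: brk_neq0 => k /= e.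
  have : (IZR (2 * k) = 1)%R.
    by rewrite mult_IZR; apply: (Rmult_eq_reg_r (INR r)); lra.
  by move=> /eq_IZR; lia.
have h1 := brk_product ((v + u) / 2) ((v - u) / 2).
have h2 := brk_product ((v - u) / 2) ((v + u) / 2).
rewrite (_ : (v + u) / 2 + (v - u) / 2 = v) in h1; last by field.
rewrite (_ : (v + u) / 2 - (v - u) / 2 = u) in h1; last by field.
rewrite (_ : (v - u) / 2 + (v + u) / 2 = v) in h2; last by field.
rewrite (_ : (v - u) / 2 - (v + u) / 2 = - u) in h2; last by field.
have e : brk x r v * brk x r (- u) = brk x r v * - brk x r u.
  rewrite h2; transitivity (- (brk x r v * brk x r u)); last by ring.
  rewrite h1; ring.
move: (brk x r v) (brk x r u) (brk x r (- u)) nv e => b c d nb e.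
transitivity (/ b * (b * d)); first by field.
by rewrite e; field.
Qed.
End BracketProperties.

(** * Continuity and the exceptional values of [p] *)

Section BracketContinuity.
Variables (x : R) (r : nat).
Hypotheses (x01 : (0 < x < 1)%R) (r0 : (0 < r)%N).
Local Notation lam := (ln x).
Local Notation L := (RtoC (ln x)).
Local Notation rr := (RtoC (INR r)).
Local Notation psi := (theta_summand x r).
Local Open Scope R_scope.

Lemma theta_summand_sub_le u : exists c0 c1, 0 <= c0 /\ forall s a, Cmod s <= 1 ->
  Cmod (psi (u + s)%C a - psi u a)%C
  <= Cmod s * (c0 * (Cmod (psi u a) * exp (c1 * Rabs (IZR a)))).
Proof.
have rp := INR_r_gt0 r0; have rn := rr_neq0 r0.
pose d0 := Rabs lam * ((2 * Cmod u + 1) / INR r + 1).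
pose d1 := Rabs lam * 2.
(* With t = d0 + d1 |a| the exponent satisfies |w| <= |s| t, and 3 |s| t e^t <= 3 |s| e^(2t): the
   constants are doubled to absorb the factor t. *)
exists (3 * exp (2 * d0)), (2 * d1); split.
  by have := exp_pos (2 * d0); lra.
move=> s a s1.
pose w := (L * ((2 * (u + rr * RtoC (IZR a)) * s + s * s) / rr - s))%C.
have e1 : psi (u + s)%C a = (psi u a * cexp w)%C.
  rewrite /theta_summand /theta_term /xpow -Cmult_assoc -cexp_add; congr (_ * cexp _)%C.
  by rewrite /w; field.
have hw : Cmod w <= Cmod s * (d0 + d1 * Rabs (IZR a)).
  have -> : w = (L * (s * ((2 * u + s) / rr + (2 * RtoC (IZR a) - 1))))%C by rewrite /w; field.
  rewrite !Cmod_mult Cmod_R.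
  have h : Cmod ((2 * u + s) / rr + (2 * RtoC (IZR a) - 1))%C
      <= (2 * Cmod u + 1) / INR r + (2 * Rabs (IZR a) + 1).
    apply: Rle_trans (Cmod_triangle _ _) _; apply: Rplus_le_compat.
      rewrite Cmod_div // Cmod_R (Rabs_pos_eq (INR r)); last lra.
      apply: Rmult_le_compat_r; first by apply: Rlt_le; apply: Rinv_0_lt_compat.
      apply: Rle_trans (Cmod_triangle _ _) _; rewrite Cmod_mult Cmod_R Rabs_pos_eq; lra.
    apply: Rle_trans (Cmod_triangle _ _) _.
    rewrite Cmod_opp Cmod_1 Cmod_mult !Cmod_R (Rabs_pos_eq 2); lra.
  have hs := Cmod_ge_0 s; have hl := Rabs_pos lam.
  apply: (Rle_trans _ (Rabs lam * (Cmod s * ((2 * Cmod u + 1) / INR r + (2 * Rabs (IZR a) + 1))))).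
    by apply: Rmult_le_compat_l => //; apply: Rmult_le_compat_l.
  by right; rewrite /d0 /d1; ring.
set t := d0 + d1 * Rabs (IZR a) in hw.
have s0 := Cmod_ge_0 s; have w0 := Cmod_ge_0 w.
have t0 : 0 <= t.
  rewrite /t /d0 /d1; have := Rabs_pos lam => hl; have := Rabs_pos (IZR a) => ha.
  have : 0 <= (2 * Cmod u + 1) / INR r.
    by apply: Rlt_le; apply: Rdiv_lt_0_compat => //; have := Cmod_ge_0 u; lra.
  move=> h; apply: Rplus_le_le_0_compat; repeat apply: Rmult_le_pos; lra.
have wt : Cmod w <= t.
  by apply: Rle_trans hw _; rewrite -{2}[t]Rmult_1_l; apply: Rmult_le_compat_r.
have te : t <= exp t by have := exp_ineq1_le t; lra.
have k : Cmod (cexp w - 1)%C <= Cmod s * (3 * (exp t * exp t)).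
  apply: Rle_trans (cexp_sub1 w) _.
  have ew : exp (Cmod w) <= exp t by apply: exp_le.
  have et := exp_pos t; have ew0 := exp_pos (Cmod w).
  apply: (Rle_trans _ (3 * (Cmod s * t) * exp t)).
    by apply: Rmult_le_compat; lra.
  have : Cmod s * t * exp t <= Cmod s * exp t * exp t.
    by apply: Rmult_le_compat_r; [lra|apply: Rmult_le_compat_l].
  lra.
rewrite e1 (_ : (psi u a * cexp w - psi u a)%C = (psi u a * (cexp w - 1))%C); last by ring.
rewrite Cmod_mult.
apply: (Rle_trans _ (Cmod (psi u a) * (Cmod s * (3 * (exp t * exp t))))).
  by apply: Rmult_le_compat_l => //; exact: Cmod_ge_0.
right; rewrite -exp_plus (_ : t + t = 2 * d0 + 2 * d1 * Rabs (IZR a)); last by rewrite /t; ring.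
rewrite exp_plus; ring.
Qed.

(** The termwise bounds have a finite sum, so all partial sums share one constant, and it survives
    in the limit. *)
Lemma brk_locally_lipschitz u : exists K, forall s, Cmod s <= 1 ->
  Cmod (brk x r (u + s)%C - brk x r u)%C <= K * Cmod s.
Proof.
have [c0 [c1 [c00 hc]]] := theta_summand_sub_le u.
have [l hl] := gauss_bounded_rsumZ (gauss_bounded_mul_exp c1 (gauss_bounded_theta_summand x01 r0 u)).
exists (c0 * l) => s s1.
apply: (Clim_bound (Clim_sub (brk_series x01 r0 (u + s)%C) (brk_series x01 r0 u))) => N.
have -> : (csumZ N (psi (u + s)%C) - csumZ N (psi u))%C
   = \big[Cplus/RtoC 0]_(a <- zs N) (psi (u + s)%C a - psi u a)%C.
  rewrite [RHS](eq_bigr (fun a => psi (u + s)%C a + RtoC (-1) * psi u a)%C); last by move=> a _; ring.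
  rewrite big_split /= -(bigC_distrr _ _ (RtoC (-1))) /csumZ; ring.
apply: Rle_trans (Cmod_bigC _ _ _) _.
apply: Rle_trans (@bigR_le _ (zs N) xpredT _ _ (fun a _ => hc s a s1)) _.
rewrite -!bigR_distrr -/(rsumZ N _) (_ : c0 * l * Cmod s = Cmod s * (c0 * l)); last by ring.
apply: Rmult_le_compat_l; first exact: Cmod_ge_0.
apply: Rmult_le_compat_l => //.
apply: (rsumZ_le_lim _ hl) => a; apply: Rmult_le_pos; first exact: Cmod_ge_0.
by apply: Rlt_le; exact: exp_pos.
Qed.

Lemma Clim_brk s u : Clim s u -> Clim (fun n => brk x r (s n)) (brk x r u).
Proof.
move=> h; have [K hK] := brk_locally_lipschitz u.
apply: (is_lim_seq_le_le_loc (fun=> 0) _ (fun n => K * Cmod (s n - u)%C)).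
- have [N hN] := (is_lim_seq_spec _ _).2 h (mkposreal 1 Rlt_0_1).
  exists N => n /hN /=; rewrite Rminus_0_r Rabs_pos_eq; last exact: Cmod_ge_0.
  move=> h1; split; first exact: Cmod_ge_0.
  rewrite {1}(_ : s n = (u + (s n - u))%C); last by ring.
  by apply: hK; lra.
- exact: is_lim_seq_const.
- rewrite (_ : Rbar.Finite 0 = Rbar.Finite (K * 0)); last by f_equal; ring.
  by apply: is_lim_seq_mult' => //; exact: is_lim_seq_const.
Qed.
End BracketContinuity.

(** * Continuity of the star product in p *)

Lemma Clim_cprod (l : seq nat) (F : nat -> nat -> C) (G : nat -> C) :
  (forall j, Clim (fun N => F N j) (G j)) -> Clim (fun N => cprod l (F N)) (cprod l G).
Proof.
by move=> h; elim: l => [|j l IH] /=; [exact: Clim_const|exact: Clim_mul].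
Qed.

Lemma Clim_symrange a s (F : nat -> vars -> C) G :
  (forall w, Clim (fun N => F N w) (G w)) ->
  forall w, Clim (fun N => symrange a s (F N) w) (symrange a s G w).
Proof.
move=> h; elim: s a => [|s IH] a w; first exact: h.
rewrite /symrange /= /symswp; apply: Clim_mul; last exact: Clim_const.
by apply: Clim_add; exact: IH.
Qed.

Section ChainContinuity.
Variables (br : C -> C) (delta : C).
Hypothesis br_cont : forall s u, Clim s u -> Clim (fun n => br (s n)) (br u).

Lemma Clim_br_sub y s u : Clim s u -> Clim (fun n => br (y - s n)) (br (y - u)).
Proof. by move=> h; apply: br_cont; apply: Clim_sub => //; exact: Clim_const. Qed.

(** The varying shifts occur only in numerators; denominators and weights stay constant along the
    sequence. *)
Lemma Clim_chain (a b e e' : nat -> nat -> C) a0 b0 e0 e0' j s w :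
  (forall l, Clim (fun N => a N l) (a0 l)) -> (forall l, Clim (fun N => b N l) (b0 l)) ->
  (forall l, Clim (fun N => e N l) (e0 l)) -> (forall l, Clim (fun N => e' N l) (e0' l)) ->
  Clim (fun N => chain br delta (a N) (b N) (e N) (e' N) j s w)
       (chain br delta a0 b0 e0 e0' j s w).
Proof.
move=> ha hb he he'.
have hsite l : Clim (fun N => site br (e N) (e' N) l w) (site br e0 e0' l w).
  by apply: Clim_mul; exact: Clim_br_sub.
apply: Clim_mul => //; apply: Clim_cprod => l.
apply: Clim_mul => //; apply: Clim_mul; last exact: Clim_const.
apply: Clim_mul; last exact: Clim_const.
apply: Clim_mul; last exact: Clim_const.
by apply: Clim_mul; exact: Clim_br_sub.
Qed.
End ChainContinuity.

Lemma Clim_kext m k (p : nat -> C) p0 l : Clim p p0 ->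
  Clim (fun N => kext m (fun j => k j + p N) l) (kext m (fun j => k j + p0) l).
Proof.
move=> h; rewrite /kext; case: ifP => _; first exact: Clim_const.
case: ifP => _; first exact: Clim_const.
by apply: Clim_add => //; exact: Clim_const.
Qed.

Lemma Clim_bond_shift i m k (p : nat -> C) p0 delta l : Clim p p0 ->
  Clim (fun N => bond_shift i m (fun j => k j + p N) delta l)
       (bond_shift i m (fun j => k j + p0) delta l).
Proof.
move=> h; apply: Clim_mul; last exact: Clim_const.
by apply: Clim_add; [exact: Clim_kext|exact: Clim_const].
Qed.

Lemma Clim_site_shift i m k (p : nat -> C) p0 delta kap l : Clim p p0 ->
  Clim (fun N => site_shift i m (fun j => k j + p N) delta kap l)
       (site_shift i m (fun j => k j + p0) delta kap l).
Proof.
move=> h; apply: Clim_add; last exact: Clim_const.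
apply: Clim_mul; last exact: Clim_const.
apply: Clim_add; last exact: Clim_const.
by apply: Clim_sub; exact: Clim_kext.
Qed.

Section StarContinuity.
Variables (x : R) (r n i m : nat) (delta : C) (k : nat -> C).
Variables (p : nat -> C) (p0 : C) (w : vars) (kap : nat -> C).
Hypotheses (x01 : (0 < x < 1)%R) (r0 : (0 < r)%N) (i0 : (1 <= i)%N) (im : (i + m <= n - 1)%N).
Hypothesis hp : Clim p p0.

Lemma Clim_star_r :
  Clim (fun N => star x r n delta (ftype i m) (ftype i m) (fk x r delta i m k)
                   (fk x r delta i m (fun j => k j + p N)) w kap)
       (star x r n delta (ftype i m) (ftype i m) (fk x r delta i m k)
                   (fk x r delta i m (fun j => k j + p0)) w kap).
Proof.
apply: (Clim_ext (fun N => esym (star_symrange x r delta k (fun j => k j + p N) w kap i0 im))).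
rewrite star_symrange //; apply: Clim_symrange => w'; apply: Clim_cmul; apply: Clim_chain.
- exact: Clim_brk.
- by move=> l; exact: Clim_const.
- by move=> l; exact: Clim_bond_shift.
- by move=> l; exact: Clim_const.
- by move=> l; exact: Clim_site_shift.
Qed.

Lemma Clim_star_l :
  Clim (fun N => star x r n delta (ftype i m) (ftype i m)
                   (fk x r delta i m (fun j => k j + p N)) (fk x r delta i m k) w kap)
       (star x r n delta (ftype i m) (ftype i m)
                   (fk x r delta i m (fun j => k j + p0)) (fk x r delta i m k) w kap).
Proof.
apply: (Clim_ext (fun N => esym (star_symrange x r delta (fun j => k j + p N) k w kap i0 im))).
rewrite star_symrange //; apply: Clim_symrange => w'; apply: Clim_cmul; apply: Clim_chain.
- exact: Clim_brk.
- by move=> l; exact: Clim_bond_shift.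
- by move=> l; exact: Clim_const.
- by move=> l; exact: Clim_site_shift.
- by move=> l; exact: Clim_const.
Qed.
End StarContinuity.

(** * Removal of the factor [q + delta] *)

Lemma fk_shift_trivial x r (delta : C) i m k p : delta = 0 \/ m = 0%N ->
  fk x r delta i m (fun j => k j + p) = fk x r delta i m k.
Proof.
move=> h; apply: functional_extensionality => w; apply: functional_extensionality => kap.
rewrite !fkE; case: h => ->.
  congr (_ * _); apply: eq_cprod => l _; rewrite /bond_shift /site_shift.
    by rewrite !Cmult_0_r.
  by congr brk; ring.
congr (_ * _); apply: eq_cprod => l; rewrite mem_iota => hl.
have -> : l = i by lia.
by rewrite /site_shift subnn.
Qed.

Lemma near_nonzero_brk x r u : (0 < x < 1)%R -> (0 < r)%N ->
  exists s : nat -> R, is_lim_seq s 0%R /\ forall N, brk x r (u + RtoC (s N)) <> 0.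
Proof.
move=> x01 r0; have rp := INR_r_gt0 r0.
pose k := (up (Re u / INR r) - 1)%Z.
have [k1 k2] : (IZR k * INR r <= Re u < IZR k * INR r + INR r)%R.
  have [h1 h2] := archimed (Re u / INR r).
  have e : (Re u = Re u / INR r * INR r)%R by field; lra.
  have f1 : (IZR k * INR r <= Re u / INR r * INR r)%R.
    by apply: Rmult_le_compat_r; rewrite ?minus_IZR; lra.
  have f2 : (Re u / INR r * INR r < (IZR k + 1) * INR r)%R.
    by apply: Rmult_lt_compat_r; rewrite ?minus_IZR; lra.
  lra.
(* [g] is the distance from Re u to the next multiple of r. The displacements g / (N+2) lie strictly
   between 0 and [g], so the displaced real part avoids all multiples. *)
set g := (IZR k * INR r + INR r - Re u)%R.
have g0 : (0 < g)%R by rewrite /g; lra.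
exists (fun N => (g * / INR N.+2)%R); split.
  rewrite (_ : Rbar.Finite 0 = Rbar.Finite (g * 0)%R); last by f_equal; ring.
  apply: is_lim_seq_mult'; first exact: is_lim_seq_const.
  have h : is_lim_seq (fun N => INR N.+2) p_infty.
    by apply: (is_lim_seq_ext (fun N => INR (N + 2))) ((is_lim_seq_incr_n _ 2 _).1 is_lim_seq_INR) => N;
      congr INR; lia.
  exact: (is_lim_seq_inv _ _ h).
move=> N; have i0 : (0 < / INR N.+2 < 1)%R.
  have h : (1 < INR N.+2)%R by rewrite !S_INR; have := pos_INR N; lra.
  split; first by apply: Rinv_0_lt_compat; lra.
  by rewrite -Rinv_1; apply: Rinv_lt_contravar; lra.
have b0 : (0 < g * / INR N.+2)%R by apply: Rmult_lt_0_compat; lra.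
have b1 : (g * / INR N.+2 < g * 1)%R by apply: Rmult_lt_compat_l; lra.
move: (g * / INR N.+2)%R b0 b1 => s b0 b1.
apply: brk_neq0 => // k'; rewrite re_plus /= => e.
have l1 : (IZR k < IZR k')%R by apply: (Rmult_lt_reg_r (INR r)) => //; rewrite -e; lra.
have l2 : (IZR k' < IZR (k + 1))%R.
  by rewrite plus_IZR; apply: (Rmult_lt_reg_r (INR r)) => //; rewrite -e; move: b1; rewrite /g; lra.
by move: l1 l2 => /lt_IZR l1 /lt_IZR l2; lia.
Qed.

Theorem theoremB1 (n r : nat) (x : R) (delta : C) (i m : nat)
    (k : nat -> C) (p : C) :
  (2 <= n)%nat -> (0 < r)%nat -> (0 < x < 1)%R ->
  (1 <= i)%nat -> (i + m <= n - 1)%nat ->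
  forall (w : vars) (kap : nat -> C),
    generic x r n (fun j => (ftype i m j + ftype i m j)%nat) w ->
    star x r n delta (ftype i m) (ftype i m)
      (fk x r delta i m k) (fk x r delta i m (fun j => (k j + p)%C)) w kap
    = star x r n delta (ftype i m) (ftype i m)
      (fk x r delta i m (fun j => (k j + p)%C)) (fk x r delta i m k) w kap.
Proof.
move=> n2 r0 x01 i0 im w kap gen.
(* If delta = 0 the shift p is multiplied by zero; if m = 0 only the fixed values k_0 and k_1 occur.
   Either way f = g. *)
have [d0|d0] := Ceq_dec delta 0; first by rewrite fk_shift_trivial //; left.
have [m0|m0] := posnP m; first by rewrite fk_shift_trivial //; right.
have gw : good (brk x r) i (i + m) w.
  by move=> l hl; apply: gen; rewrite ?ftypeE ?hl //; lia.
have [s [s0 hs]] := near_nonzero_brk (p * delta + delta) x01 r0.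
(* Chosen so that p' delta + delta = p delta + delta + s, where the bracket does not vanish and can
   be cancelled for each N. *)
pose p' N := p + RtoC (s N) / delta.
have hp : Clim p' p.
  have h : Clim (fun N => RtoC (s N)) 0.
    by apply: (is_lim_seq_ext (fun N => Rabs (s N - 0))) (is_lim_seq_Rabs0 s0) => N;
      rewrite -RtoC_minus Cmod_R.
  have := Clim_add (Clim_const p) (Clim_mul h (Clim_const (/ delta))).
  by rewrite Cmult_0_l Cplus_0_r.
apply: (Clim_unique (Clim_star_r delta k w kap x01 r0 i0 im hp)).
apply: Clim_ext (Clim_star_l delta k w kap x01 r0 i0 im hp) => N.
have := star_comm_scaled delta k (p' N) kap (brk_odd x01 r0) (brk_three_term x01 r0) i0 m0 im gw.
rewrite /=.
have -> : p' N * delta + delta = p * delta + delta + RtoC (s N) by rewrite /p'; field.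
move: (hs N); set b := brk _ _ _; set A := star _ _ _ _ _ _ _ _ _ _; set B := star _ _ _ _ _ _ _ _ _ _.
move=> nb e; transitivity (/ b * (b * B)); first by field.
by rewrite -e; field.
Qed.
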